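(* The following estimates hold uniformly for all $\epsilon\in(0,1)$ and all non-zero integers $n$: $$A_n^{(\epsilon)}=O\Big(\log\frac{1}{\epsilon}\Big),\qquad B_n^{(\epsilon)}\leq 0.631\,\epsilon\log|n|+O(1).$$
   Context: Let $n$ be a non-zero integer. A set $S$ of positive integers is a Diophantine tuple with the property $D(n)$ (or ''has the property $D(n)$'') if $ab+n$ is a perfect square for each $a,b\in S$ with $a\neq b$. For each $\epsilon>0$, let $$A_n^{(\epsilon)}=\sup\{|S\cap(|n|^{2+\epsilon},+\infty)| : S \text{ has the property } D(n)\},$$ $$B_n^{(\epsilon)}=\sup\{|S\cap(n^2,|n|^{2+\epsilon}]| : S \text{ has the property } D(n)\}.$$ Here $\log$ denotes the natural logarithm, and uniformity means that the constants implied by the $O$-notation are absolute, i.e. independent of both $\epsilon$ and $n$.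
   Formalization: The first estimate is proved as A_n^(ε) = O(max(1, log(1/ε))), since O(log(1/ε)) on all of (0,1) is false: A_n^(ε) ≥ 1 always (one large integer), while log(1/ε) → 0 as ε → 1; for ε ≤ 1/e the two bounds coincide. *)

(* Defs.v *)
From HB Require Import structures.
From mathcomp Require Import all_boot all_order all_algebra.
From mathcomp Require Import all_classical all_reals all_analysis.

Set Implicit Arguments.
Unset Strict Implicit.
Unset Printing Implicit Defensive.

Import Order.TTheory GRing.Theory Num.Theory.
Import numFieldNormedType.Exports.

Local Open Scope classical_set_scope.
Local Open Scope ring_scope.

(* Perfect squares are the k ^+ 2 with k : int, so 0 counts as a square.
   S is not assumed to be finite. *)
Definition diophantine_tuple (n : int) (S : set nat) : Prop :=
  (forall a, S a -> (0 < a)%N) /\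
  (forall a b, S a -> S b -> a <> b ->
     exists k : int, a%:Z * b%:Z + n = k ^+ 2).

(* Cardinalities and suprema are taken in the extended reals: [counting X] is
   the cardinality of X, and +oo when X is infinite. *)
Definition A_sup (R : realType) (n : int) (eps : R) : \bar R :=
  ereal_sup [set counting (S `&` [set a : nat |
                             `|n|%:~R `^ (2 + eps) < a%:R])
            | S in [set S | diophantine_tuple n S]].

Definition B_sup (R : realType) (n : int) (eps : R) : \bar R :=
  ereal_sup [set counting (S `&` [set a : nat |
                             (n ^+ 2)%:~R < a%:R :> R /\
                             a%:R <= `|n|%:~R `^ (2 + eps)])
            | S in [set S | diophantine_tuple n S]].

(* Main.v *)
Require Import Defs.
From HB Require Import structures.
From mathcomp Require Import all_boot all_order all_algebra.
From mathcomp Require Import finmap.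
From mathcomp Require Import all_classical all_reals all_analysis.
From mathcomp Require Import zify ring lra.

(** Why the estimates hold.

    Let [S] have the property D(n), and let [a_0 < a_1 < ...] be elements of [S]
    exceeding [n ^ 2].

    Gap principle.  For a triple [a < b < c] with
    [a b + n = r ^ 2], [a c + n = s ^ 2], [b c + n = t ^ 2], the integer
    [e = n (a + b + c) + 2 a b c - 2 r s t] makes [a e + n ^ 2] a square.  As
    [a > n ^ 2] this forces [e >= 0].  If [e > 0], then [c] is at least
    [3 a b / n ^ 2]; if [e = 0], then [c = a + b + 2 r], which cannot happen for both
    of the triples [(a, c, d)] and [(b, c, d)].  Hence four consecutive elements
    satisfy [v_i v_(i+2) <= v_(i+3)], where [v_i = 3 a_i / n ^ 2] ([quadruple_gap],
    [scaled_gap]).  The [v_i] thus grow doubly exponentially: they are squared in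
    every three steps ([scaled_pow]).  For the elements below [|n| ^ (2 + eps)]
    already a geometric growth of ratio [3 ^ 8] gives the bound on [B].

    For [A], the first element exceeds [|n| ^ (2 + eps)], so after
    [O(log (1 / eps))] steps the elements exceed any fixed power of [|n|].  It
    remains to bound the number of such very large elements by an absolute
    constant.  Among boundedly many of them one finds [a < b < c < d] with [c]
    larger than a high power of [b |n|] and [d] larger than a high power of [c].
    This is impossible ([large_gap]): if [a d + n = x ^ 2], [b d + n = y ^ 2] and
    [c d + n = z ^ 2], then [s x / (a z)] and [t y / (b z)] approximate
    [sqrt (1 + n / (a c))] and [sqrt (1 + n / (b c))] with an error of order
    [z ^ (-2)], whereas the hypergeometric method of Thue, Siegel, Baker and
    Rickert shows that two such numbers, so close to [1], have no simultaneous
    approximation with an exponent much larger than [3/2].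

    The hypergeometric method in polynomial form ([sqrt_simultaneous]).  Suppose
    integers [u_j] are close to [q sqrt (1 + a_j / N)] at three nodes [a_j] much
    smaller than [N].  Near [a_j], the function
    [f(z) = (4 N) ^ k (1 + z / N) ^ (k + 1/2)] has the jet of
    [4 ^ k (N + z) ^ (k + 1/2) / sqrt (N + a_j)], times [sqrt (1 + a_j / N)].  So the
    polynomial [h] of degree at most [3 k + 2] that interpolates, to order [k] at
    the three nodes, [u_j] times the first factor has two features.  Its
    coefficients are integers up to a denominator exponential in [k]
    ([hermite], [gbin_half_int]).  And it is close to [q] times the truncation of
    [f] in degree less than [3 k], so its three leading coefficients are tiny, hence
    zero.  Then [(N + z) h' - (k + 1/2) h] has degree less than [3 k] but [3 k] zeros;
    it vanishes, and so does [h], since the degree of a nonzero polynomial solution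
    would be [k + 1/2] ([half_power_interpolant_degree]). *)

Set Implicit Arguments.
Unset Strict Implicit.
Unset Printing Implicit Defensive.

Import Order.TTheory GRing.Theory Num.Theory.
Import numFieldNormedType.Exports.

Local Open Scope ring_scope.

(** * Binomial coefficients of half-integral exponent *)

Definition gbin (R : numFieldType) (x : R) (r : nat) : R :=
  (\prod_(i < r) (x - i%:R)) / r`!%:R.

Lemma gbin0 (R : numFieldType) (x : R) : gbin x 0 = 1.
Proof. by rewrite /gbin big_ord0 divr1. Qed.

Lemma gbinS (R : numFieldType) (x : R) (r : nat) :
  r.+1%:R * gbin x r.+1 = (x - r%:R) * gbin x r.
Proof.
rewrite /gbin big_ord_recr /= factS natrM.
have h1 : (r`!%:R : R) != 0 by rewrite pnatr_eq0 -lt0n fact_gt0.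
have h2 : (r.+1%:R : R) != 0 by rewrite pnatr_eq0.
by field; rewrite h1 addrC natr1 h2.
Qed.

Lemma gbin_pascal (R : numFieldType) (x : R) (r : nat) :
  gbin (x + 1) r.+1 = gbin x r.+1 + gbin x r.
Proof.
have h2 s : (s.+1%:R : R) != 0 by rewrite pnatr_eq0.
apply: (mulfI (h2 r)); rewrite gbinS mulrDr gbinS.
elim: r => [|r IH]; first by rewrite !gbin0 subr0; ring.
have IH' : gbin (x + 1) r.+1 = gbin x r.+1 + gbin x r.
  by apply: (mulfI (h2 r)); rewrite gbinS mulrDr gbinS IH.
have := gbinS x r; rewrite IH' -!natr1 => E.
rewrite mulrDr; have -> : (x + 1 - (r%:R + 1)) * gbin x r = (r%:R + 1) * gbin x r.+1.
  by rewrite E; ring.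
ring.
Qed.

(** Extracting the Taylor coefficient of order [r] from the binomial series of
    exponent [x] leaves the binomial series of exponent [x - r]. *)
Lemma gbin_mul_bin (R : numFieldType) (x : R) (r m : nat) :
  gbin x (r + m) * 'C(r + m, r)%:R = gbin x r * gbin (x - r%:R) m.
Proof.
elim: m => [|m IH]; first by rewrite addn0 binn gbin0.
have h (s : nat) : (s.+1%:R : R) != 0 by rewrite pnatr_eq0.
apply: (mulfI (h m)); rewrite mulrCA [RHS]mulrCA gbinS.
have E : m.+1%:R * 'C(r + m.+1, r)%:R = (r + m).+1%:R * 'C(r + m, r)%:R :> R.
  rewrite -!natrM; congr (_%:R); rewrite addnS.
  by rewrite (mul_bin_down (r + m).+1 r) subSn ?leq_addr // addKn.
rewrite E addnS mulrCA mulrA gbinS natrD opprD addrA.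
rewrite [RHS]mulrCA -IH; ring.
Qed.

(** The denominators stay exponential in [r]: at [-1/2] the number is
    [(-1) ^ r 'C(2r, r)], and Pascal's rule raises the exponent by [1]. *)
Lemma gbin_half_int (R : realType) (k r : nat) :
  4 ^+ r * gbin (k%:R + 2^-1 : R) r \is a Num.int.
Proof.
have base (s : nat) : 4 ^+ s * gbin (- 2^-1 : R) s \is a Num.int.
  have -> : 4 ^+ s * gbin (- 2^-1 : R) s = (-1) ^+ s * 'C(s.*2, s)%:R.
    elim: s => [|s IH]; first by rewrite gbin0 !expr0 bin0.
    have h : (s.+1%:R : R) != 0 by rewrite pnatr_eq0.
    apply: (mulfI h); rewrite mulrCA gbinS.
    have E : s.+1%:R * 'C(s.+1.*2, s.+1)%:R = 2 * (s.*2.+1)%:R * 'C(s.*2, s)%:R :> R.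
      rewrite -!natrM; congr (_%:R).
      have E1 := mul_bin_diag s.*2.+2 s; have E2 := mul_bin_down s.*2.+1 s.
      rewrite doubleS -E1 -mulnA E2 mulnA; congr (_ * _)%N; lia.
    rewrite exprS -mulrA [X in 4 * X]mulrCA [4 * _]mulrCA IH [RHS]mulrCA E.
    rewrite -!natr1 -muln2 natrM exprS; by field.
  by rewrite rpredM ?rpredX ?rpredN ?rpred1 ?natr_int.
have step (x : R) : (forall s, 4 ^+ s * gbin x s \is a Num.int) ->
    forall s, 4 ^+ s * gbin (x + 1) s \is a Num.int.
  move=> H [|s]; first by rewrite gbin0 expr0 mulr1 rpred1.
  rewrite gbin_pascal mulrDr rpredD // exprS -mulrA rpredM //.
  exact: (natr_int _ 4).
elim: k r => [|k IH] r.
  by have := step _ base r; congr (_ * gbin _ _ \is a _); field.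
by have := step _ IH r; congr (_ * gbin _ _ \is a _); rewrite -[k.+1%:R]natr1; ring.
Qed.

(** Again from [-1/2] upwards, each use of Pascal's rule doubling the bound. *)
Lemma gbin_half_le (R : realFieldType) (k r : nat) :
  `|gbin (k%:R + 2^-1 : R) r| <= 2 ^+ k.+1.
Proof.
have base (s : nat) : `|gbin (- 2^-1 : R) s| <= 1.
  elim: s => [|s IH]; first by rewrite gbin0 normr1.
  have h : (0 : R) < s.+1%:R by rewrite ltr0n.
  rewrite -(ler_pM2l h) -[X in X * `|_|](ger0_norm (ltW h)) -normrM gbinS normrM.
  rewrite ler_pM // ?normr_ge0 //.
  rewrite -normrN opprD !opprK ger0_norm; last by rewrite addr_ge0 ?invr_ge0.
  by rewrite -[s.+1%:R]natr1; lra.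
have step (x B : R) : 1 <= B -> (forall s, `|gbin x s| <= B) ->
    forall s, `|gbin (x + 1) s| <= 2 * B.
  move=> B1 H [|s]; first by rewrite gbin0 normr1; lra.
  rewrite gbin_pascal; apply: le_trans (ler_normD _ _) _.
  by have := H s.+1; have := H s; lra.
elim: k r => [|k IH] r.
  rewrite expr1 -[X in _ <= X]mulr1; have := step _ 1 (lexx _) base r.
  by congr (`|gbin _ _| <= _); field.
rewrite exprS; have := step _ _ _ IH r; rewrite exprn_ege1 ?ler1n // => /(_ isT).
by congr (`|gbin _ _| <= _); rewrite -[k.+1%:R]natr1; ring.
Qed.

(** * Truncated binomial series *)

(** With [|t| <= |X|] as the domain, both signs of [X] are treated at once. *)
Lemma mvt_from0 (R : realType) (f df : R -> R) (X : R) :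
  (forall t : R, `|t| <= `|X| -> is_derive t 1 f (df t)) ->
  exists2 c, `|c| <= `|X| & f X - f 0 = df c * X.
Proof.
move=> D.
have cont a b : (forall t, t \in `[a, b] -> `|t| <= `|X|) ->
    {within `[a, b], continuous f}%classic.
  by move=> H; apply: derivable_within_continuous => t /H /D [].
have [X0|X0] := leP 0 X.
  have H t : t \in `[0, X] -> `|t| <= `|X|.
    by rewrite in_itv /= => /andP[t0 tX]; rewrite !ger0_norm.
  have [c cI E] := MVT_segment X0 (fun t tI => D t (H t (subset_itv_oo_cc tI)))
    (cont _ _ H).
  by exists c; [exact: H | rewrite E subr0].
have H t : t \in `[X, 0] -> `|t| <= `|X|.
  by rewrite in_itv /= => /andP[tX t0]; rewrite !ler0_norm ?lerN2 // ltW.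
have [c cI E] := MVT_segment (ltW X0) (fun t tI => D t (H t (subset_itv_oo_cc tI)))
    (cont _ _ H).
by exists c; [exact: H | rewrite -opprB E sub0r mulrN opprK].
Qed.

(** If [p] is the truncated binomial series of [sqrt (1 + t)], the derivative of
    [p / sqrt (1 + t)] is a single monomial over [(1 + t) ^ (3/2)], because the
    series solves [(1 + t) y' = y / 2]. *)
Lemma sqrt_taylor (R : realType) (H : nat) (X : R) : `|X| <= 2^-1 ->
  `|Num.sqrt (1 + X) - \sum_(i < H.+1) gbin (2^-1 : R) i * X ^+ i|
    <= (32 * H.+1)%:R * `|X| ^+ H.+1.
Proof.
move=> hX; set b := gbin (2^-1 : R).
pose p := \poly_(i < H.+1) b i.
have pE t : p.[t] = \sum_(i < H.+1) b i * t ^+ i by rewrite horner_poly.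
rewrite -pE.
(* All coefficients of the defect cancel except the one at the truncation. *)
have ode t : p^`().[t] * (1 + t) - p.[t] / 2 = - (H.+1%:R * b H.+1) * t ^+ H.
  have -> : p^`().[t] * (1 + t) - p.[t] / 2 =
      (p^`() * (1 + 'X) - 2^-1 *: p).[t].
    by rewrite !hornerE; ring.
  suff -> : p^`() * (1 + 'X) - 2^-1 *: p = (- (H.+1%:R * b H.+1)) *: 'X^H.
    by rewrite !hornerE.
  apply/polyP => i; rewrite mulrDr mulr1 !coefB !coefD coefMX !coefZ coefXn !coef_deriv.
  rewrite !coef_poly /=.
  have S j : b j.+1 *+ j.+1 = (2^-1 - j%:R) * b j.
    by rewrite -[LHS]mulr_natl; exact: gbinS.
  case: i => [|i] /=.
    rewrite ltnS; case: (posnP H) => [->|H0] /=.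
      have := S 0%N; rewrite mulr1n /b gbin0 => ->; ring.
    by rewrite S eq_sym gtn_eqF //=; ring.
  rewrite !ltnS; have [iH|iH|<-] := ltngtP i.+1 H.
  - by rewrite S -[_ *+ i.+1]mulr_natl /=; ring.
  - by rewrite /=; ring.
  - by rewrite [i.+2%:R * _]mulr_natl (S i.+1) -[_ *+ i.+1]mulr_natl /=; ring.
have s0 (t : R) : `|t| <= `|X| -> 2^-1 <= 1 + t.
  by move=> tX; have : `|t| <= 2^-1 := le_trans tX hX; rewrite ler_norml => /andP[+ _]; lra.
pose f (t : R) := p.[t] * (Num.sqrt (1 + t))^-1.
pose df (t : R) : R := - (H.+1%:R * b H.+1) * t ^+ H * (Num.sqrt (1 + t))^-1 ^+ 3.
have [|c cX E] := @mvt_from0 R f df X.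
  move=> t /s0 tX.
  have t1 : 0 < 1 + t by lra.
  have sn : Num.sqrt (1 + t) != 0 by rewrite gt_eqF // sqrtr_gt0.
  have d1 : is_derive t (1:R) (fun t => 1 + t) 1.
    rewrite -[X in is_derive _ _ _ X]add0r.
    exact: (is_deriveD (is_derive_cst (1 : R) t 1) (is_derive_id t 1)).
  have d2 : is_derive t (1:R) (fun t => Num.sqrt (1 + t))
      ((2 * Num.sqrt (1 + t))^-1 * 1).
    exact: (@is_derive1_comp R Num.sqrt (fun t => 1 + t) t _ _
      (is_derive1_sqrt t1) d1).
  have d3 := @is_deriveV R (fun t => Num.sqrt (1 + t)) t _ 1 sn d2.
  have d4 := is_deriveM (is_derive_poly p t) d3.
  apply: is_derive_eq d4 _; rewrite /df -ode /GRing.scale /= mulr1.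
  have E : 1 + t = Num.sqrt (1 + t) ^+ 2 by rewrite sqr_sqrtr // ltW.
  move: sn E; set s := Num.sqrt _ => sn E; rewrite [X in _ * X - _]E.
  by field.
have sX := s0 _ (lexx `|X|).
have f0 : f 0 = 1.
  rewrite /f pE big_ord_recl /b gbin0 mulr1 addr0 sqrtr1 invr1 mulr1 big1 ?addr0 //.
  by move=> i _; rewrite exprS mul0r mulr0.
have sqX : Num.sqrt (1 + X) != 0 by rewrite gt_eqF // sqrtr_gt0; lra.
have -> : Num.sqrt (1 + X) - p.[X] = - (Num.sqrt (1 + X) * (df c * X)).
  by rewrite -E f0 /f; field.
have b2 : `|b H.+1| <= 2.
  by have := gbin_half_le R 0 H.+1; rewrite add0r expr1.
rewrite normrN /df; move: (b H.+1) b2 => bH b2.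
rewrite !normrM normrN !normrM !normrX [ `|X| ^+ H.+1]exprSr natrM.
have s2 : `|Num.sqrt (1 + X)| <= 2.
  rewrite ger0_norm ?sqrtr_ge0 // -[X in _ <= X]ger0_norm // -sqrtr_sqr ler_wsqrtr //.
  by move: hX; rewrite ler_norml => /andP[_]; lra.
have s3 : `|(Num.sqrt (1 + c))^-1| <= 2.
  rewrite ger0_norm ?invr_ge0 ?sqrtr_ge0 // -[X in _ <= X]invrK lef_pV2 ?posrE //.
    rewrite -[X in X <= _]ger0_norm // -sqrtr_sqr ler_wsqrtr //.
    by have := s0 _ cX; lra.
  by rewrite sqrtr_gt0; have := s0 _ cX; lra.
rewrite (ger0_norm (ler0n R _)).
have -> : 32 * H.+1%:R * (`|X| ^+ H * `|X|) =
    2 * (H.+1%:R * 2 * `|X| ^+ H * 2 ^+ 3 * `|X|) :> R.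
  by ring.
rewrite !ler_pM ?mulr_ge0 ?exprn_ge0 //.
- by rewrite lerXn2r ?nnegrE.
Qed.

(** Multiplying the binomial series by [1 + X] is Pascal's rule, so the exponent
    climbs from [1/2] to [m + 1/2]. *)
Lemma half_power_taylor (R : realType) (m H : nat) (X : R) : `|X| <= 2^-1 ->
  `|(1 + X) ^+ m * Num.sqrt (1 + X)
     - \sum_(i < H.+1) gbin (m%:R + 2^-1 : R) i * X ^+ i|
    <= 2 ^+ m * (32 * H.+1 + 2 * m)%:R * `|X| ^+ H.+1.
Proof.
move=> hX; elim: m => [|m IH].
  by rewrite !expr0 !mul1r add0r addn0; exact: sqrt_taylor.
have X2 : `|1 + X| <= 2.
  by apply: le_trans (ler_normD _ _) _; rewrite normr1; lra.
set b := gbin (m%:R + 2^-1 : R) in IH *.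
have -> : (1 + X) ^+ m.+1 * Num.sqrt (1 + X)
     - \sum_(i < H.+1) gbin (m.+1%:R + 2^-1 : R) i * X ^+ i =
   (1 + X) * ((1 + X) ^+ m * Num.sqrt (1 + X) - \sum_(i < H.+1) b i * X ^+ i)
   + b H * X ^+ H.+1.
  have -> : m.+1%:R + 2^-1 = m%:R + 2^-1 + 1 :> R by rewrite -[m.+1%:R]natr1; ring.
  have -> : \sum_(i < H.+1) gbin (m%:R + 2^-1 + 1 : R) i * X ^+ i =
      (1 + X) * (\sum_(i < H.+1) b i * X ^+ i) - b H * X ^+ H.+1.
    elim: {IH} H => [|H IH]; first by rewrite !big_ord1 /b !gbin0; ring.
    by rewrite big_ord_recr /= IH [in RHS]big_ord_recr /= gbin_pascal -/b !exprS; ring.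
  by rewrite exprS; ring.
apply: le_trans (ler_normD _ _) _; rewrite [X in X + _]normrM [X in _ + X]normrM normrX.
have A : `|1 + X| * `|(1 + X) ^+ m * Num.sqrt (1 + X) - \sum_(i < H.+1) b i * X ^+ i|
    <= 2 * (2 ^+ m * (32 * H.+1 + 2 * m)%:R * `|X| ^+ H.+1).
  by rewrite ler_pM.
have B : `|b H| * `|X| ^+ H.+1 <= 2 ^+ m.+1 * `|X| ^+ H.+1.
  by rewrite ler_wpM2r ?exprn_ge0 ?gbin_half_le.
apply: le_trans (lerD A B) _.
have -> : (32 * H.+1 + 2 * m.+1 = (32 * H.+1 + 2 * m).+2)%N by lia.
move: (32 * H.+1 + 2 * m)%N => K.
rewrite [2 ^+ m.+1]exprS -[K.+2%:R]natr1 -[K.+1%:R]natr1.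
have P : 0 <= 2 ^+ m * `|X| ^+ H.+1 by rewrite mulr_ge0 ?exprn_ge0.
rewrite -subr_ge0; apply: le_trans (mulr_ge0 (ler0n R 2) P) _.
by rewrite le_eqVlt; apply/orP; left; apply/eqP; ring.
Qed.

(** * Sum norm and congruences of polynomials *)

(** The sum norm is submultiplicative, which makes every size estimate below a
    product of elementary ones. *)
Definition pnorm (R : numDomainType) (p : {poly R}) : R :=
  \sum_(i < size p) `|p`_i|.

Lemma pnormE (R : numDomainType) (p : {poly R}) n : (size p <= n)%N ->
  pnorm p = \sum_(i < n) `|p`_i|.
Proof.
move=> pn; rewrite /pnorm (big_ord_widen n (fun i => `|p`_i|) pn) big_mkcond /=.
apply: eq_bigr => i _; case: ltnP => // h.
by rewrite nth_default // normr0.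
Qed.

Lemma pnorm_ge0 (R : numDomainType) (p : {poly R}) : 0 <= pnorm p.
Proof. by apply: sumr_ge0 => i _; exact: normr_ge0. Qed.

Lemma coef_le_pnorm (R : numDomainType) (p : {poly R}) i : `|p`_i| <= pnorm p.
Proof.
case: (ltnP i (size p)) => h; last by rewrite nth_default // normr0 pnorm_ge0.
rewrite /pnorm (bigD1 (Ordinal h)) //= lerDl.
by apply: sumr_ge0 => j _; exact: normr_ge0.
Qed.

Lemma pnorm0 (R : numDomainType) : pnorm (0 : {poly R}) = 0.
Proof. by rewrite /pnorm size_poly0 big_ord0. Qed.

Lemma pnormD (R : numDomainType) (p q : {poly R}) :
  pnorm (p + q) <= pnorm p + pnorm q.
Proof.
rewrite (pnormE (size_polyD p q)) (pnormE (leq_maxl (size p) (size q))).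
rewrite (pnormE (leq_maxr (size p) (size q))) -big_split /=.
by apply: ler_sum => i _; rewrite coefD ler_normD.
Qed.

Lemma pnorm_sum (R : numDomainType) I (r : seq I) (P : pred I) (F : I -> {poly R}) :
  pnorm (\sum_(i <- r | P i) F i) <= \sum_(i <- r | P i) pnorm (F i).
Proof.
elim/big_rec2: _ => [|i x y _ h]; first by rewrite pnorm0.
by apply: le_trans (pnormD _ _) _; rewrite lerD2l.
Qed.

Lemma pnormZ (R : numDomainType) (c : R) (p : {poly R}) :
  pnorm (c *: p) = `|c| * pnorm p.
Proof.
rewrite (pnormE (size_scale_leq c p)) /pnorm mulr_sumr.
by apply: eq_bigr => i _; rewrite coefZ normrM.
Qed.

Lemma pnormC (R : numDomainType) (c : R) : pnorm c%:P = `|c|.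
Proof. by rewrite (pnormE (size_polyC_leq1 c)) big_ord1 coefC. Qed.

Lemma pnormMX (R : numDomainType) (p : {poly R}) : pnorm (p * 'X) = pnorm p.
Proof.
have h : (size (p * 'X)%R <= (size p).+1)%N.
  by apply: leq_trans (size_polyMleq _ _) _; rewrite size_polyX addn2.
rewrite (pnormE h) big_ord_recl coefMX normr0 add0r /pnorm.
by apply: eq_bigr => i _; rewrite coefMX.
Qed.

Lemma pnormM (R : numDomainType) (p q : {poly R}) :
  pnorm (p * q) <= pnorm p * pnorm q.
Proof.
have pX n : pnorm (q * 'X^n) = pnorm q.
  elim: n => [|n IH]; first by rewrite mulr1.
  by rewrite exprSr mulrA pnormMX.
rewrite -{1}[p]coefK poly_def mulr_suml.
apply: le_trans (pnorm_sum _ _ _) _; rewrite [X in _ <= X * _]/pnorm mulr_suml.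
by apply: ler_sum => i _; rewrite -scalerAl pnormZ mulrC -[_ * q]mulrC pX mulrC.
Qed.

Lemma pnormXn (R : numDomainType) (p : {poly R}) n : pnorm (p ^+ n) <= pnorm p ^+ n.
Proof.
elim: n => [|n IH]; first by rewrite pnormC normr1.
rewrite !exprS; apply: le_trans (pnormM _ _) _.
by rewrite ler_wpM2l ?pnorm_ge0.
Qed.

Lemma pnorm_prod (R : numDomainType) I (r : seq I) (P : pred I) (F : I -> {poly R}) :
  pnorm (\prod_(i <- r | P i) F i) <= \prod_(i <- r | P i) pnorm (F i).
Proof.
elim/big_rec2: _ => [|i x y _ h]; first by rewrite pnormC normr1.
by apply: le_trans (pnormM _ _) _; rewrite ler_wpM2l ?pnorm_ge0.
Qed.

Lemma pnorm_XaddC (R : numDomainType) (c : R) : pnorm ('X + c%:P) = 1 + `|c|.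
Proof.
rewrite /pnorm size_XaddC big_ord_recl big_ord1 !coefD !coefX !coefC /=.
by rewrite add0r addr0 normr1 addrC.
Qed.

Lemma pnorm_take (R : numDomainType) m (p : {poly R}) :
  pnorm (take_poly m p) <= pnorm p.
Proof.
have h : (size (take_poly m p) <= maxn m (size p))%N.
  by rewrite (leq_trans (size_take_poly _ _)) ?leq_maxl.
rewrite (pnormE h) (pnormE (leq_maxr m (size p))).
apply: ler_sum => i _; rewrite coef_take_poly.
by case: ifP => // _; rewrite normr0.
Qed.

Lemma pnorm_comp (R : numDomainType) (p q : {poly R}) n : (size p <= n.+1)%N ->
  1 <= pnorm q -> pnorm (p \Po q) <= pnorm p * pnorm q ^+ n.
Proof.
move=> pn q1; rewrite comp_polyE.
apply: le_trans (pnorm_sum _ _ _) _; rewrite [X in _ <= X * _]/pnorm mulr_suml.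
apply: ler_sum => i _; rewrite pnormZ ler_wpM2l //.
apply: le_trans (pnormXn _ _) _; apply: ler_weXn2l => //.
by have := leq_trans (ltn_ord i) pn; rewrite ltnS.
Qed.

Lemma take_polyM_take (R : nzRingType) m (p q : {poly R}) :
  take_poly m (p * q) = take_poly m (take_poly m p * q).
Proof.
rewrite -{1}[p](poly_take_drop m) mulrDl take_polyD -mulrA -(commr_polyXn q m).
by rewrite mulrA take_polyMXn_0 addr0.
Qed.

Lemma dvdp_prodB (R : fieldType) (d : {poly R}) I (r : seq I) (P : pred I)
    (F G : I -> {poly R}) : (forall i, P i -> d %| F i - G i) ->
  d %| \prod_(i <- r | P i) F i - \prod_(i <- r | P i) G i.
Proof.
move=> h; elim/big_rec2: _ => [|i x y /h Pi xy]; first by rewrite subrr dvdp0.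
have -> : F i * y - G i * x = (F i - G i) * y + G i * (y - x) by ring.
by apply: dvdp_add; [apply: dvdp_mulr | apply: dvdp_mull].
Qed.

Lemma dvdXn_take (R : fieldType) m (p : {poly R}) : 'X^m %| p - take_poly m p.
Proof.
by rewrite -{1}[p](poly_take_drop m) addrAC subrr add0r dvdp_mulIr.
Qed.

(** The powers of the distinct [X - a j] are coprime, so their product divides
    [p]. *)
Lemma multi_roots_eq0 (R : fieldType) (I : finType) (a : I -> R) m (p : {poly R}) :
  injective a -> (forall j, ('X - (a j)%:P) ^+ m %| p) ->
  (size p <= #|I| * m)%N -> p = 0.
Proof.
move=> ainj ap sp; apply/eqP/negPn/negP => p0.
have h (s : seq I) : uniq s -> \prod_(j <- s) ('X - (a j)%:P) ^+ m %| p.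
  elim: s => [|j s IH] /=; first by rewrite big_nil dvd1p.
  case/andP => js us; rewrite big_cons Gauss_dvdp ?ap ?IH //.
  apply: coprimep_expl; rewrite big_seq; elim/big_ind: _ => [|x y|i is_].
  - exact: coprimep1.
  - by rewrite coprimepMr => -> ->.
  - apply: coprimep_expr; rewrite coprimep_XsubC root_XsubC.
    by apply: contraNneq js => /ainj <-.
have := dvdp_leq p0 (h _ (enum_uniq I)).
rewrite big_enum /= size_prod => [|i _]; last by rewrite expf_eq0 polyXsubC_eq0 andbF.
rewrite (eq_bigr (fun _ => m.+1)) => [|i _]; last by rewrite size_exp_XsubC.
rewrite sum_nat_const; have -> : #|xpredT : pred I| = #|I| by [].
by move: sp; move: #|I| (size p) => c sz; lia.
Qed.

(** Expanding [((X + b) - X) ^ (2k+1) = b ^ (2k+1)] inverts [(X + b) ^ (k+1)]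
    modulo [X ^ (k+1)] with integral coefficients; the common denominator
    [b ^ (2k+1)] is only exponential in [k]. *)
Lemma inverse_mod_Xn (R : realType) (k : nat) (b : R) :
  exists G : {poly R},
    [/\ 'X^(k.+1) %| G * ('X + b%:P) ^+ k.+1 - (b ^+ (2 * k).+1)%:P,
        b \is a Num.int -> G \is a polyOver Num.int_num_subdef &
        pnorm G <= 2 ^+ (2 * k).+1 * (1 + `|b|) ^+ k].
Proof.
exists (\sum_(i < k.+1)
  (('X + b%:P) ^+ i * (- 'X) ^+ (k - i)) *+ 'C((2 * k).+1, k.+1 + i)); split.
- have -> : (b ^+ (2 * k).+1)%:P = (- 'X + ('X + b%:P)) ^+ (2 * k).+1.
    by rewrite addrA addNr add0r rmorphXn.
  rewrite (exprDn (- 'X)); have -> : ((2 * k).+2 = k.+1 + k.+1)%N by lia.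
  rewrite big_split_ord /= mulr_suml opprD addrCA -sumrB.
  rewrite [X in _ + X]big1 => [|i _]; last first.
    apply/eqP; rewrite subr_eq0; apply/eqP; rewrite mulrnAl; congr (_ *+ _).
    have -> : ((2 * k).+1 - (k.+1 + i) = k - i)%N by lia.
    by rewrite exprD; ring.
  rewrite addr0 dvdpNr; elim/big_ind: _ => [|x y|i _]; [exact: dvdp0 | exact: dvdp_add|].
  have -> : ((2 * k).+1 - i = k.+1 + (k - i))%N by have := ltn_ord i; lia.
  rewrite -mulr_natr exprD -!mulrA exprNn -mulrA mulrCA.
  by rewrite dvdp_mulr ?dvdpp.
- move=> bi; apply: rpred_sum => i _; apply: rpredMn; apply: rpredM.
    by rewrite rpredX // rpredD ?polyOverX // polyOverC.
  by rewrite rpredX // rpredN polyOverX.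
- apply: le_trans (pnorm_sum _ _ _) _.
  have le2 : \sum_(i < k.+1) 'C((2 * k).+1, k.+1 + i)%:R <= 2 ^+ (2 * k).+1 :> R.
    rewrite -natr_sum -natrX ler_nat.
    have := expnDn 1 1 (2 * k).+1; rewrite addn1 => ->.
    have -> : ((2 * k).+2 = k.+1 + k.+1)%N by lia.
    rewrite big_split_ord /=; apply: leq_trans (leq_addl _ _).
    by apply: leq_sum => i _; rewrite !exp1n !muln1.
  apply: le_trans (ler_wpM2r _ le2); last by rewrite exprn_ge0 // addr_ge0.
  rewrite mulr_suml; apply: ler_sum => i _.
  rewrite -mulr_natl -polyC_natr mul_polyC pnormZ ger0_norm //.
  rewrite ler_wpM2l //; apply: le_trans (pnormM _ _) _.
  have p1 : pnorm (- 'X : {poly R}) = 1.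
    by rewrite -scaleN1r pnormZ normrN1 mul1r -['X]mul1r pnormMX pnormC normr1.
  have -> : (1 + `|b|) ^+ k = (1 + `|b|) ^+ k * 1 by rewrite mulr1.
  rewrite ler_pM ?pnorm_ge0 //.
    apply: le_trans (pnormXn _ _) _; rewrite pnorm_XaddC ler_weXn2l ?lerDl //.
    by rewrite -ltnS.
  by apply: le_trans (pnormXn _ _) _; rewrite p1 expr1n.
Qed.

(** * Hermite interpolation *)

Lemma dvdp_shift (R : fieldType) (c : R) (d p : {poly R}) :
  (d \Po ('X + c%:P) %| p \Po ('X + c%:P)) = (d %| p).
Proof.
apply/idP/idP => [|/dvdp_comp_poly//].
by move/(dvdp_comp_poly ('X - c%:P)); rewrite !comp_polyXaddC_K.
Qed.

Lemma XsubC_shift (R : nzRingType) (a c : R) :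
  ('X - a%:P) \Po ('X + c%:P) = 'X + (c - a)%:P :> {poly R}.
Proof. by rewrite comp_polyB comp_polyX comp_polyC rmorphB addrA. Qed.

Lemma comp_polyXn (R : comNzRingType) (p q : {poly R}) n :
  (p ^+ n) \Po q = (p \Po q) ^+ n.
Proof. by rewrite rmorphXn. Qed.

Lemma comp_polyXsubC_K (R : fieldType) (p : {poly R}) (c : R) :
  (p \Po ('X - c%:P)) \Po ('X + c%:P) = p.
Proof. by have := comp_polyXaddC_K p (- c); rewrite polyCN opprK. Qed.

(** The truncated product is the jet at [a j] of
    [t * \prod_(l != j) (X - a l) ^ - (k+1)], up to the denominator; multiplying by
    [\prod_(l != j) (X - a l) ^ (k+1)] restores [t] at [a j] and kills the jets at
    the other nodes. *)
Lemma hermite_node (R : realType) (I : finType) (a : I -> R) (k : nat) (L : R)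
    (j : I) (t : {poly R}) :
  2 <= L -> (forall l, 1 + `|a l| <= L) -> (forall l, 1 + `|a j - a l| <= L) ->
  exists h : {poly R},
    [/\ (size h <= #|I| * k.+1)%N,
        ('X - (a j)%:P) ^+ k.+1 %|
          h - (\prod_(l | l != j) (a j - a l) ^+ (2 * k).+1)
                *: (t \Po ('X - (a j)%:P)),
        (forall l, l != j -> ('X - (a l)%:P) ^+ k.+1 %| h),
        ((forall l, a l \is a Num.int) -> t \is a polyOver Num.int_num_subdef ->
          h \is a polyOver Num.int_num_subdef) &
        pnorm h <= L ^+ ((4 * k + 2) * #|I|.-1 + k) * pnorm (take_poly k.+1 t)].
Proof.
move=> L2 aL aaL.
have L1 : 1 <= L by apply: le_trans L2; rewrite ler1n.
have L0 : 0 <= L by apply: le_trans L1.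
have [G HG] := choice (fun l => inverse_mod_Xn k (a j - a l)).
have cardI : #|[pred l | l != j]| = #|I|.-1 by rewrite cardC1.
set u := take_poly k.+1 (t * \prod_(l | l != j) G l).
have szu : (size u <= k.+1)%N by exact: size_take_poly.
set Q := \prod_(l | l != j) ('X - (a l)%:P) ^+ k.+1.
exists ((u \Po ('X - (a j)%:P)) * Q); split.
- apply: leq_trans (size_polyMleq _ _) _.
  have -> : size Q = (#|I|.-1 * k.+1).+1.
    rewrite /Q size_prod => [|i _]; last by rewrite expf_eq0 polyXsubC_eq0 andbF.
    rewrite (eq_bigr (fun _ => k.+2)) => [|i _]; last by rewrite size_exp_XsubC.
    rewrite sum_nat_const !cardI; move: #|I|.-1 => c; lia.
  rewrite size_comp_poly2 ?size_XsubC // addnS /=.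
  have : (0 < #|I|)%N by apply/card_gt0P; exists j.
  by move: #|I| szu => c; case: c => // c; rewrite mulSn leq_add2r.
- rewrite -(dvdp_shift (a j)) comp_polyXn XsubC_shift subrr polyC0 addr0.
  rewrite comp_polyB comp_polyM comp_polyZ.
  rewrite !comp_polyXsubC_K.
  have -> : Q \Po ('X + (a j)%:P) = \prod_(l | l != j) ('X + (a j - a l)%:P) ^+ k.+1.
    by rewrite /Q rmorph_prod; apply: eq_bigr => l _; rewrite /= comp_polyXn XsubC_shift.
  set Q' := \prod_(_ | _) _.
  have -> : u * Q' - \prod_(l | l != j) (a j - a l) ^+ (2 * k).+1 *: t =
    - ((t * \prod_(l | l != j) G l - u) * Q') +
    t * ((\prod_(l | l != j) G l) * Q'
         - (\prod_(l | l != j) (a j - a l) ^+ (2 * k).+1)%:P).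
    by rewrite -mul_polyC; ring.
  apply: dvdp_add; first by rewrite dvdpNr dvdp_mulr // dvdXn_take.
  rewrite dvdp_mull // -big_split /= rmorph_prod /=.
  by apply: dvdp_prodB => l _; have [] := HG l.
- by move=> l lj; rewrite dvdp_mull // /Q (bigD1 l) //= dvdp_mulIl.
- move=> ai ti; apply: rpredM.
    apply: polyOver_comp; last by rewrite rpredB ?polyOverX ?polyOverC // ai.
    apply/polyOverP => i; rewrite coef_take_poly; case: ifP => _; last exact: rpred0.
    move: i; apply/polyOverP; apply: rpredM => //; apply: rpred_prod => l _.
    by have [_ Gi _] := HG l; apply: Gi; rewrite rpredB.
  by apply: rpred_prod => l _; rewrite rpredX // rpredB ?polyOverX // polyOverC ai.
- have XL l : pnorm ('X - (a l)%:P) <= L by rewrite -polyCN pnorm_XaddC normrN.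
  have XL1 l : 1 <= pnorm ('X - (a l)%:P) by rewrite -polyCN pnorm_XaddC lerDl.
  have nQ : pnorm Q <= L ^+ (k.+1 * #|I|.-1).
    apply: le_trans (pnorm_prod _ _ _) _; rewrite exprM -cardI -prodr_const.
    apply: ler_prod => l _; rewrite pnorm_ge0 /=.
    by apply: le_trans (pnormXn _ _) _; rewrite lerXn2r ?nnegrE ?pnorm_ge0.
  have nG : pnorm (\prod_(l | l != j) G l) <= L ^+ ((3 * k).+1 * #|I|.-1).
    apply: le_trans (pnorm_prod _ _ _) _; rewrite exprM -cardI -prodr_const.
    apply: ler_prod => l _; rewrite pnorm_ge0 /=.
    have [_ _ Gn] := HG l; apply: le_trans Gn _.
    have -> : ((3 * k).+1 = (2 * k).+1 + k)%N by lia.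
    rewrite exprD ler_pM ?exprn_ge0 ?addr_ge0 //.
      by rewrite lerXn2r ?nnegrE.
    by rewrite lerXn2r ?nnegrE ?addr_ge0.
  have nu : pnorm (u \Po ('X - (a j)%:P)) <=
      pnorm (take_poly k.+1 t) * L ^+ ((3 * k).+1 * #|I|.-1) * L ^+ k.
    apply: le_trans (pnorm_comp szu (XL1 j)) _.
    rewrite ler_pM ?pnorm_ge0 ?exprn_ge0 ?pnorm_ge0 //; last first.
      by rewrite lerXn2r ?nnegrE ?pnorm_ge0.
    rewrite /u take_polyM_take; apply: le_trans (pnorm_take _ _) _.
    by apply: le_trans (pnormM _ _) _; rewrite ler_wpM2l ?pnorm_ge0.
  apply: le_trans (pnormM _ _) _.
  have := ler_pM (pnorm_ge0 _) (pnorm_ge0 _) nu nQ => /le_trans; apply.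
  rewrite -!mulrA -!exprD mulrC ler_wpM2r ?pnorm_ge0 //.
  by rewrite le_eqVlt; apply/orP; left; apply/eqP; congr (_ ^+ _); lia.
Qed.

(** Summing over the nodes.  Both the common denominator [D] and the factor in the
    bound are exponential in [k], which is what the comparison of an integer with
    a power of [N] can afford. *)
Lemma hermite (R : realType) (I : finType) (a : I -> R) (k : nat) (L : R)
    (t : I -> {poly R})
    (D := \prod_i \prod_(l | l != i) (a i - a l) ^+ (2 * k).+1) :
  2 <= L -> (forall i, 1 + `|a i| <= L) -> (forall i l, 1 + `|a i - a l| <= L) ->
  exists h : {poly R},
    [/\ (size h <= #|I| * k.+1)%N,
        (forall j, ('X - (a j)%:P) ^+ k.+1 %| h - D *: (t j \Po ('X - (a j)%:P))),
        ((forall i, a i \is a Num.int) ->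
          (forall j, t j \is a polyOver Num.int_num_subdef) ->
          h \is a polyOver Num.int_num_subdef) &
        pnorm h <= L ^+ ((2 * k).+1 * #|I|.-1 ^ 2 + (4 * k + 2) * #|I|.-1 + k) *
                   \sum_j pnorm (take_poly k.+1 (t j))].
Proof.
move=> L2 aL aaL.
have L1 : 1 <= L by apply: le_trans L2; rewrite ler1n.
have L0 : 0 <= L by apply: le_trans L1.
pose w i := \prod_(l | l != i) (a i - a l) ^+ (2 * k).+1.
have cardI (j : I) : #|[pred l | l != j]| = #|I|.-1 by rewrite cardC1.
have [h Hh] := choice (fun j => hermite_node k (t j) L2 aL (aaL j)).
exists (\sum_j (\prod_(i | i != j) w i) *: h j); split.
- elim/big_ind: _ => [|x y hx hy|j _]; first by rewrite size_poly0.
    by rewrite (leq_trans (size_polyD _ _)) // geq_max hx.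
  by rewrite (leq_trans (size_scale_leq _ _)) //; have [] := Hh j.
- move=> j; rewrite (bigD1 j) //= addrAC; apply: dvdp_add; last first.
    elim/big_ind: _ => [|x y|i ij]; [exact: dvdp0 | exact: dvdp_add |].
    rewrite -mul_polyC dvdp_mull //; have [_ _ + _ _] := Hh i; apply.
    by rewrite eq_sym.
  have -> : D = (\prod_(i | i != j) w i) * w j by rewrite /D (bigD1 j) //= mulrC.
  rewrite -scalerA -scalerBr.
  by rewrite -mul_polyC dvdp_mull //; have [] := Hh j.
- move=> ai ti; apply: rpred_sum => j _; rewrite -mul_polyC; apply: rpredM.
    rewrite polyOverC; apply: rpred_prod => i _; apply: rpred_prod => l _.
    by rewrite rpredX // rpredB // ai.
  by have [_ _ _ + _] := Hh j; apply.
- apply: le_trans (pnorm_sum _ _ _) _; rewrite mulr_sumr; apply: ler_sum => j _.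
  rewrite pnormZ -addnA exprD -mulrA ler_pM ?pnorm_ge0 //; last by have [] := Hh j.
  rewrite normr_prod expnS expn1 [X in _ ^+ X]mulnA exprM -[X in _ <= _ ^+ X](cardI j).
  rewrite -prodr_const; apply: ler_prod => i _; rewrite normr_ge0 /= normr_prod exprM.
  rewrite -(cardI i) -prodr_const; apply: ler_prod => l _; rewrite normr_ge0 /= normrX.
  rewrite lerXn2r ?nnegrE //; apply: le_trans (aaL i l); by rewrite lerDr.
Qed.

(** * The differential equation of the half power *)

(** The jet of order [k] at [a] of [4 ^ k * (N + z) ^ (k + 1/2)], divided by
    [sqrt (N + a)]. *)
Definition half_power_jet (R : numFieldType) (k : nat) (N a : R) : {poly R} :=
  \poly_(r < k.+1) (4 ^+ k * gbin (k%:R + 2^-1) r * (N + a) ^+ (k - r)).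

Lemma dvdp_deriv_exp (R : fieldType) (c : R) k (p : {poly R}) :
  ('X - c%:P) ^+ k.+1 %| p -> ('X - c%:P) ^+ k %| p^`().
Proof.
case/dvdpP => q ->; rewrite derivM deriv_exp derivXsubC mul1r /= -mulr_natl.
apply: dvdp_add; first by rewrite exprS mulrA dvdp_mulIr.
by rewrite mulrA dvdp_mulIr.
Qed.

Lemma half_power_jet_ode (R : numFieldType) (k : nat) (N a : R) :
  'X^k %| ('X + (N + a)%:P) * (half_power_jet k N a)^`()
            - (k%:R + 2^-1) *: half_power_jet k N a.
Proof.
set S := half_power_jet k N a; rewrite -[X in _ %| X](poly_take_drop k).
suff -> : take_poly k (('X + (N + a)%:P) * S^`() - (k%:R + 2^-1) *: S) = 0.
  by rewrite add0r dvdp_mull.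
apply/polyP => r; rewrite coef_take_poly coef0; case: ltnP => // rk.
rewrite coefB mulrDl coefD -['X * _]mulrC coefMX coefZ coefCM !coef_deriv.
rewrite !coef_poly !ltnS rk (ltnW rk) /=.
set M := N + a; set x := k%:R + 2^-1.
have -> : (if r == 0%N then 0 else
    (if (r.-1.+1 < k.+1)%N then 4 ^+ k * gbin x r.-1.+1 * M ^+ (k - r.-1.+1) else 0)
      *+ r.-1.+1) = r%:R * (4 ^+ k * gbin x r * M ^+ (k - r)).
  by case: r rk => [|r] rk /=; [rewrite mul0r | rewrite ltnS (ltnW rk) mulr_natl].
have E := gbinS x r.
have -> : M * (4 ^+ k * gbin x r.+1 * M ^+ (k - r.+1) *+ r.+1) =
    4 ^+ k * (r.+1%:R * gbin x r.+1) * M ^+ (k - r).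
  by rewrite -[in RHS](subnSK rk) exprS -mulr_natl; ring.
by rewrite E; ring.
Qed.

(** An interpolant [h] of such low degree solves the differential equation
    [(N + z) y' = (k + 1/2) y] of the half power: the defect has too many zeros.
    That equation has no polynomial solution but [0], as the degree of a
    solution would be [k + 1/2]. *)
Lemma half_power_interpolant_degree (R : realType) (I : finType) (a : I -> R)
    (k : nat) (N : R) (u : I -> R) (h : {poly R}) :
  injective a -> (forall j, N + a j != 0) -> (size h <= #|I| * k)%N ->
  (forall j, ('X - (a j)%:P) ^+ k.+1 %|
     h - u j *: (half_power_jet k N (a j) \Po ('X - (a j)%:P))) ->
  forall j, u j = 0.
Proof.
move=> ainj Na sh hu.
pose op (p : {poly R}) := ('X + N%:P) * p^`() - (k%:R + 2^-1) *: p.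
have opB p q : op (p - q) = op p - op q.
  by rewrite /op derivB scalerBr mulrBr; ring.
have op0 : op h = 0.
  have [->|hn0] := eqVneq h 0; first by rewrite /op deriv0 mulr0 scaler0 subrr.
  apply: (multi_roots_eq0 ainj (m := k)) => [j|].
    pose p := half_power_jet k N (a j) \Po ('X - (a j)%:P).
    have -> : op h = op (h - u j *: p) + op (u j *: p) by rewrite opB subrK.
    apply: dvdp_add.
      apply: dvdp_sub; first by apply/dvdp_mull/dvdp_deriv_exp/hu.
      by rewrite -mul_polyC; apply/dvdp_mull/(dvdp_trans _ (hu j))/dvdp_exp2l.
    rewrite -(dvdp_shift (a j)) comp_polyXn XsubC_shift subrr polyC0 addr0.
    rewrite /op derivZ /p deriv_comp derivXsubC mulr1.
    rewrite comp_polyB comp_polyM comp_polyD comp_polyX comp_polyC !comp_polyZ.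
    rewrite !comp_polyXsubC_K.
    have -> : ('X + (a j)%:P + N%:P) * (u j *: (half_power_jet k N (a j))^`()) -
        (k%:R + 2^-1) *: (u j *: half_power_jet k N (a j)) =
      u j *: (('X + (N + a j)%:P) * (half_power_jet k N (a j))^`() -
        (k%:R + 2^-1) *: half_power_jet k N (a j)).
      by rewrite -!mul_polyC rmorphD /=; ring.
    by rewrite -mul_polyC; apply/dvdp_mull/half_power_jet_ode.
  apply: leq_trans sh; apply: leq_trans (size_polyD _ _) _.
  rewrite size_polyN geq_max size_scale_leq andbT.
  apply: leq_trans (size_polyMleq _ _) _; rewrite size_XaddC /=.
  exact: lt_size_deriv.
have h0 : h = 0.
  apply/eqP/negPn/negP => hn0.
  have szh : (0 < size h)%N by rewrite size_poly_gt0.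
  have := congr1 (fun p : {poly R} => p`_(size h).-1) op0.
  rewrite /op coefB mulrDl coefD -['X * _]mulrC coefMX coefZ coefCM !coef_deriv coef0.
  rewrite (prednK szh) (nth_default 0 (leqnn (size h))) mul0rn mulr0 addr0 => E.
  have lc : h`_(size h).-1 != 0 by rewrite -lead_coefE lead_coef_eq0.
  have : ((size h).-1%:R - (k%:R + 2^-1)) * h`_(size h).-1 = 0.
    rewrite mulrBl -{}[RHS]E; congr (_ - _).
    by case: (size h).-1 => [|d] /=; rewrite ?mul0r // mulr_natl.
  move/eqP; rewrite mulf_eq0 (negPf lc) orbF subr_eq0 => /eqP D.
  have : ((size h).-1 * 2 = (2 * k).+1)%N.
    by apply/eqP; rewrite -(eqr_nat R) natrM D -[(2 * k).+1%:R]natr1 natrM; apply/eqP; field.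
  lia.
move=> j; have := hu j; rewrite h0 sub0r dvdpNr -(dvdp_shift (a j)).
rewrite comp_polyXn XsubC_shift subrr polyC0 addr0 comp_polyZ.
rewrite comp_polyXsubC_K => /dvdpP[q /(congr1 (fun p : {poly R} => p`_0))].
rewrite coefMXn coefZ coef_poly /= gbin0 subn0 mulr1 => /eqP.
by rewrite !mulf_eq0 !expf_eq0 (negPf (Na j)) andbF orbF pnatr_eq0 andbF orbF => /eqP.
Qed.

(** * Jets of the truncated series *)

Lemma coef_XaddC_exp (R : comNzRingType) (c : R) n r :
  (('X + c%:P) ^+ n)`_r = c ^+ (n - r) *+ 'C(n, r).
Proof.
elim: n r => [|n IH] r; first by rewrite coefC; case: r => [|r]; rewrite ?bin0.
rewrite exprSr mulrDr coefD coefMX coefMC !IH.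
case: r => [|r] /=; first by rewrite !bin0 !subn0 add0r mulr1n exprSr.
rewrite subSS binS mulrnDr addrC; congr (_ + _).
case: (ltnP r n) => h; last by rewrite bin_small // !mulr0n mul0r.
by rewrite mulrnAl -exprSr subnSK.
Qed.

(** Truncation of the binomial series of [(4 N) ^ k * (1 + z / N) ^ (k + 1/2)]. *)
Definition half_power_series (R : numFieldType) (k n : nat) (N : R) : {poly R} :=
  \poly_(h < n) (4 ^+ k * N ^+ k * gbin (k%:R + 2^-1) h / N ^+ h).

(** The jet at [a] of the truncated series is again a truncated series, by
    [gbin_mul_bin]. *)
Lemma coef_half_power_series_shift (R : numFieldType) (k n : nat) (N a : R) (r : nat) :
  N != 0 -> (r <= k)%N -> (r <= n)%N ->
  (half_power_series k n N \Po ('X + a%:P))`_r =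
  4 ^+ k * gbin (k%:R + 2^-1) r * N ^+ (k - r) *
    \sum_(m < n - r) gbin ((k - r)%:R + 2^-1) m * (a / N) ^+ m.
Proof.
move=> N0 rk rn; rewrite /half_power_series poly_def raddf_sum coef_sum /=.
set x := k%:R + 2^-1.
transitivity (\sum_(i < n) 4 ^+ k * N ^+ k * gbin x i / N ^+ i * (a ^+ (i - r) * 'C(i, r)%:R)).
  apply: eq_bigr => i _.
  by rewrite comp_polyZ comp_polyXn comp_polyX coefZ coef_XaddC_exp mulr_natr.
rewrite -(big_mkord xpredT (fun i =>
  4 ^+ k * N ^+ k * gbin x i / N ^+ i * (a ^+ (i - r) * 'C(i, r)%:R))).
rewrite (big_cat_nat (n := r)) //= big_nat_cond big1 ?add0r; last first.
  by move=> i /andP[/andP[_ ir] _]; rewrite bin_small // !mulr0.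
rewrite -{1}[r]add0n big_addn big_mkord mulr_sumr; apply: eq_bigr => m _.
have -> : (k - r)%:R + 2^-1 = x - r%:R by rewrite natrB //; rewrite /x; ring.
have E := gbin_mul_bin x r m.
rewrite [(m + r)%N]addnC addKn exprMn exprVn.
have -> : 4 ^+ k * N ^+ k * gbin x (r + m) / N ^+ (r + m) * (a ^+ m * 'C(r + m, r)%:R) =
  4 ^+ k * N ^+ k * (gbin x (r + m) * 'C(r + m, r)%:R) / N ^+ (r + m) * a ^+ m by ring.
rewrite E -[in N ^+ k](subnK rk) !exprD; field.
by rewrite !expf_neq0.
Qed.

(** Up to the factor [sqrt (1 + a / N)], the jet at [a] of the polynomial
    [half_power_series k (3 * k) N] is nearly [half_power_jet k N a]; its degree is
    below [3 k], and the error is of order [N ^ (-2k)]. *)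
Lemma half_power_jet_error (R : realType) (k : nat) (N a L : R) (r : nat) :
  (0 < k)%N -> (r <= k)%N -> 1 <= L -> `|a| <= L -> 2 * L <= N ->
  `|Num.sqrt (1 + a / N) * (half_power_jet k N a)`_r
    - (half_power_series k (3 * k) N \Po ('X + a%:P))`_r|
  <= 2 ^+ (5 * k + 8) * L ^+ (3 * k) / N ^+ (2 * k).
Proof.
move=> k0 rk L1 aL LN.
have N0 : 0 < N by lra.
have r3 : (r <= 3 * k)%N by lia.
rewrite coef_half_power_series_shift ?gt_eqF // coef_poly ltnS rk.
set x := k%:R + 2^-1.
have -> : (N + a) ^+ (k - r) = N ^+ (k - r) * (1 + a / N) ^+ (k - r).
  by rewrite -exprMn mulrDr mulr1 mulrCA divff ?mulr1 // gt_eqF.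
set X := a / N.
have X2 : `|X| <= 2^-1.
  rewrite /X normrM normfV (gtr0_norm N0) ler_pdivrMr //; lra.
have [H HE] : exists H, (3 * k - r)%N = H.+1 by exists (3 * k - r).-1; lia.
have := half_power_taylor (k - r) H X2; rewrite HE.
set A := \sum_(m < _) _; set B := (1 + X) ^+ _; set th := Num.sqrt _ => T.
have -> : th * (4 ^+ k * gbin x r * (N ^+ (k - r) * B))
    - 4 ^+ k * gbin x r * N ^+ (k - r) * A =
    4 ^+ k * gbin x r * N ^+ (k - r) * (B * th - A) by ring.
rewrite [ `|_ * (B * th - A)|]normrM.
have b1 : `|4 ^+ k * gbin x r * N ^+ (k - r)| <= 4 ^+ k * 2 ^+ k.+1 * N ^+ (k - r).
  rewrite normrM [ `|4 ^+ k * _|]normrM !normrX (gtr0_norm N0) (ger0_norm (ler0n R 4)).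
  by rewrite ler_wpM2r ?exprn_ge0 ?(ltW N0) // ler_wpM2l ?exprn_ge0 // gbin_half_le.
apply: le_trans (ler_pM _ _ b1 T) _; rewrite ?normr_ge0 //.
have c1 : (32 * H.+1 + 2 * (k - r))%:R <= 2 ^+ 7 * 2 ^+ k :> R.
  rewrite -exprD -natrX ler_nat expnD.
  have : (k < 2 ^ k)%N by exact: ltn_expl.
  by rewrite -HE; move: (2 ^ k)%N => e; lia.
have c2 : 2 ^+ (k - r) <= 2 ^+ k :> R by rewrite ler_weXn2l ?ler1n // leq_subr.
have c3 : N ^+ (k - r) * `|X| ^+ H.+1 <= L ^+ (3 * k) / N ^+ (2 * k).
  rewrite /X normrM normfV (gtr0_norm N0) exprMn exprVn -HE.
  have -> : (3 * k - r = (k - r) + 2 * k)%N by clear -rk; lia.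
  rewrite exprD [N ^+ (_ + _)]exprD.
  have -> : N ^+ (k - r) * (`|a| ^+ (k - r) * `|a| ^+ (2 * k) / (N ^+ (k - r) * N ^+ (2 * k)))
     = `|a| ^+ (k - r + 2 * k) / N ^+ (2 * k).
    by rewrite exprD; field; rewrite !expf_neq0 // gt_eqF.
  rewrite ler_wpM2r ?invr_ge0 ?exprn_ge0 ?(ltW N0) //.
  apply: (@le_trans _ _ (L ^+ (k - r + 2 * k))).
    by rewrite lerXn2r ?nnegrE // (le_trans _ L1).
  by rewrite ler_weXn2l //; clear -rk; lia.
have -> : 4 ^+ k * 2 ^+ k.+1 * N ^+ (k - r) *
  (2 ^+ (k - r) * (32 * H.+1 + 2 * (k - r))%:R * `|X| ^+ H.+1) =
  4 ^+ k * 2 ^+ k.+1 * (2 ^+ (k - r) * (32 * H.+1 + 2 * (k - r))%:R *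
    (N ^+ (k - r) * `|X| ^+ H.+1)) by ring.
have -> : 2 ^+ (5 * k + 8) * L ^+ (3 * k) / N ^+ (2 * k) =
   4 ^+ k * 2 ^+ k.+1 * (2 ^+ k * (2 ^+ 7 * 2 ^+ k) * (L ^+ (3 * k) / N ^+ (2 * k))) :> R.
  have -> : 4 ^+ k = 2 ^+ (2 * k) :> R by rewrite exprM; congr (_ ^+ _); ring.
  have -> : (5 * k + 8 = 2 * k + (k.+1 + (k + (7 + k))))%N by clear; lia.
  by rewrite !exprD; ring.
have q0 (q : R) n : 0 <= q -> 0 <= q ^+ n by exact: exprn_ge0.
rewrite ler_wpM2l ?mulr_ge0 ?q0 // ler_pM ?mulr_ge0 ?q0 ?(ltW N0) //.
by rewrite ler_pM ?q0.
Qed.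

(** * Simultaneous approximation of square roots *)

Lemma half_power_jet_int (R : realType) (k : nat) (N a : R) :
  N \is a Num.int -> a \is a Num.int ->
  half_power_jet k N a \is a polyOver Num.int_num_subdef.
Proof.
move=> Ni ai; apply/polyOverP => r; rewrite coef_poly; case: ifP => [rk|_]; last exact: rpred0.
have -> : 4 ^+ k * gbin (k%:R + 2^-1 : R) r * (N + a) ^+ (k - r) =
   4 ^+ (k - r) * (4 ^+ r * gbin (k%:R + 2^-1) r) * (N + a) ^+ (k - r).
  by rewrite mulrA -exprD subnK.
apply: rpredM; last by rewrite rpredX // rpredD.
by apply: rpredM; [rewrite rpredX // natr_int | exact: gbin_half_int].
Qed.

Lemma half_power_jet_bound (R : realType) (k : nat) (N a : R) (r : nat) :
  (r <= k)%N -> 1 <= N -> `|a| <= N ->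
  `|(half_power_jet k N a)`_r| <= 2 ^+ (4 * k + 1) * N ^+ k.
Proof.
move=> rk N1 aN; have N0 : 0 <= N by lra.
rewrite coef_poly ltnS rk normrM [ `|4 ^+ k * _|]normrM !normrX (ger0_norm (ler0n R 4)).
have -> : 2 ^+ (4 * k + 1) * N ^+ k = 4 ^+ k * 2 ^+ k.+1 * (2 * N) ^+ k :> R.
  have -> : 4 ^+ k = 2 ^+ (2 * k) :> R by rewrite exprM; congr (_ ^+ _); ring.
  have -> : (4 * k + 1 = 2 * k + (k.+1 + k))%N by lia.
  by rewrite exprMn !exprD; ring.
have q0 (q : R) n : 0 <= q -> 0 <= q ^+ n by exact: exprn_ge0.
rewrite ler_pM ?mulr_ge0 ?q0 //.
  by rewrite ler_wpM2l ?q0 // gbin_half_le.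
have Na2 : `|N + a| <= 2 * N.
  by apply: le_trans (ler_normD _ _) _; rewrite ger0_norm //; lra.
apply: (@le_trans _ _ ((2 * N) ^+ (k - r))).
  by rewrite lerXn2r ?nnegrE ?mulr_ge0.
by rewrite ler_weXn2l ?leq_subr //; lra.
Qed.

(** Let [h1] interpolate the jets [u j *: half_power_jet k N (a j)] with integral
    coefficients, and [h2] the differences between these jets and those of [q]
    times the truncated series [T].  Then [h1 = D q T + h2], where [T] has degree
    below [3 k]; if [h2] is small, the coefficients of [h1] of index at least
    [3 k] are integers of absolute value less than [1].  So [h1] has degree below
    [3 k], which [half_power_interpolant_degree] forbids. *)
Lemma sqrt_simultaneous (R : realType) (a : 'I_3 -> R) (N L q eta : R) (k : nat)
    (u : 'I_3 -> R) :
  injective a -> (forall j, a j \is a Num.int) -> N \is a Num.int ->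
  (forall j, u j \is a Num.int) -> (exists j, u j != 0) ->
  2 <= L -> (forall j, 1 + `|a j| <= L) -> (forall i j, 1 + `|a i - a j| <= L) ->
  2 * L <= N -> (0 < k)%N ->
  (forall j, `|u j - q * Num.sqrt (1 + a j / N)| <= eta) ->
  1 <= L ^+ (44 * k) * (eta * N ^+ k + `|q| / N ^+ (2 * k)).
Proof.
move=> ainj ai Ni ui [j0 uj0] L2 aL aaL LN k0 ueta.
have L1 : 1 <= L by lra.
have L0 : 0 <= L by lra.
have N1 : 1 <= N by lra.
have N0 : 0 < N by lra.
have eta0 : 0 <= eta by apply: le_trans (ueta j0).
have aN j : `|a j| <= N by have := aL j; lra.
have al j : `|a j| <= L by have := aL j; lra.
rewrite leNgt; apply/negP => small.
pose S j := half_power_jet k N (a j).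
pose T := half_power_series k (3 * k) N.
pose D := \prod_i \prod_(l | l != i) (a i - a l) ^+ (2 * k).+1.
have D0 : D != 0.
  apply/prodf_neq0 => i _; apply/prodf_neq0 => l li; rewrite expf_eq0 /= subr_eq0.
  by apply: contraNneq li => /ainj ->.
have [h1 [sh1 ch1 ih1 _]] := hermite k (fun j => u j *: S j) L2 aL aaL.
have [h2 [sh2 ch2 _ nh2]] :=
  hermite k (fun j => u j *: S j - q *: (T \Po ('X + (a j)%:P))) L2 aL aaL.
rewrite -/D in ch1 ch2.
have sT : (size T <= 3 * k)%N by exact: size_poly.
have h12 : h1 - (D * q) *: T - h2 = 0.
  apply: (multi_roots_eq0 ainj (m := k.+1)) => [j|].
    have -> : h1 - (D * q) *: T - h2 =
      (h1 - D *: ((u j *: S j) \Po ('X - (a j)%:P))) -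
      (h2 - D *: ((u j *: S j - q *: (T \Po ('X + (a j)%:P))) \Po ('X - (a j)%:P))).
      rewrite comp_polyB !comp_polyZ comp_polyXaddC_K -!mul_polyC rmorphM /=; ring.
    exact: dvdp_sub.
  apply: leq_trans (size_polyD _ _) _; rewrite size_polyN geq_max sh2 andbT.
  apply: leq_trans (size_polyD _ _) _; rewrite size_polyN geq_max sh1 /=.
  apply: leq_trans (size_scale_leq _ _) _; apply: leq_trans sT _.
  by rewrite card_ord leq_mul2l leqnSn orbT.
pose B := 2 ^+ (5 * k + 8) * L ^+ (3 * k) * (eta * N ^+ k + `|q| / N ^+ (2 * k)).
have jetB j r : (r <= k)%N ->
    `|(u j *: S j - q *: (T \Po ('X + (a j)%:P)))`_r| <= B.
  move=> rk; rewrite coefB !coefZ.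
  have -> : u j * (S j)`_r - q * (T \Po ('X + (a j)%:P))`_r =
     (u j - q * Num.sqrt (1 + a j / N)) * (S j)`_r +
     q * (Num.sqrt (1 + a j / N) * (S j)`_r - (T \Po ('X + (a j)%:P))`_r) by ring.
  apply: le_trans (ler_normD _ _) _; rewrite [ `|_ * (S j)`_r|]normrM [ `|q * _|]normrM.
  have b1 := ler_pM (normr_ge0 _) (normr_ge0 _) (ueta j) (half_power_jet_bound rk N1 (aN j)).
  have b2 := ler_wpM2l (normr_ge0 q) (half_power_jet_error k0 rk L1 (al j) LN).
  apply: le_trans (lerD b1 b2) _; rewrite /B mulrDr lerD //.
    have -> : eta * (2 ^+ (4 * k + 1) * N ^+ k) =
      2 ^+ (4 * k + 1) * 1 * (eta * N ^+ k) by ring.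
    rewrite ler_wpM2r ?mulr_ge0 ?exprn_ge0 ?(ltW N0) //.
    have e1 : 2 ^+ (4 * k + 1) <= 2 ^+ (5 * k + 8) :> R.
      by apply: ler_weXn2l; [rewrite ler1n | rewrite leq_add // leq_mul].
    have e2 : 1 <= L ^+ (3 * k) by exact: exprn_ege1.
    by move: (2 ^+ (4 * k + 1)) (2 ^+ (5 * k + 8)) (L ^+ (3 * k)) e1 e2
      (exprn_ge0 (4 * k + 1) (ler0n R 2)) => x y z; nra.
  by rewrite le_eqVlt; apply/orP; left; apply/eqP; ring.
have B0 : 0 <= B by apply: le_trans (normr_ge0 _) (jetB j0 0%N _).
have h2small : pnorm h2 < 1.
  apply: le_lt_trans nh2 (le_lt_trans _ small).
  have sB : \sum_j pnorm (take_poly k.+1 (u j *: S j - q *: (T \Po ('X + (a j)%:P))))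
      <= 3 * (k.+1%:R * B).
    have -> : 3 * (k.+1%:R * B) = \sum_(j < 3) (k.+1%:R * B).
      by rewrite sumr_const card_ord mulr_natl.
    apply: ler_sum => j _; rewrite (pnormE (size_take_poly _ _)).
    have -> : k.+1%:R * B = \sum_(r < k.+1) B by rewrite sumr_const card_ord mulr_natl.
    apply: ler_sum => r _; rewrite coef_take_poly ltn_ord; apply: jetB.
    by rewrite -ltnS.
  apply: le_trans (ler_wpM2l (exprn_ge0 _ L0) sB) _; rewrite card_ord /=.
  set e := (_ + _)%N; rewrite /B; set Y := eta * _ + _.
  have Y0 : 0 <= Y by rewrite addr_ge0 ?mulr_ge0 ?invr_ge0 ?exprn_ge0 ?(ltW N0).
  have k2 : 3 * k.+1%:R * 2 ^+ (5 * k + 8) <= L ^+ (6 * k + 10).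
    have kk : k.+1%:R <= 2 ^+ k :> R by rewrite -natrX ler_nat ltn_expl.
    have -> : (6 * k + 10 = 2 + (k + (5 * k + 8)))%N by ring.
    apply: (@le_trans _ _ (2 ^+ (2 + (k + (5 * k + 8))))).
      rewrite [2 ^+ (2 + _)]exprD [2 ^+ (k + _)]exprD mulrA.
      rewrite ler_wpM2r ?exprn_ge0 // ler_pM //.
      by rewrite expr2; lra.
    by apply: lerXn2r; rewrite ?nnegrE.
  have -> : L ^+ e * (3 * (k.+1%:R * (2 ^+ (5 * k + 8) * L ^+ (3 * k) * Y))) =
    (3 * k.+1%:R * 2 ^+ (5 * k + 8)) * (L ^+ e * L ^+ (3 * k)) * Y by ring.
  apply: ler_wpM2r => //; have LL : 0 <= L ^+ e * L ^+ (3 * k) by rewrite mulr_ge0 ?exprn_ge0.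
  apply: le_trans (ler_wpM2r LL k2) _.
  have ee : (6 * k + 10 + (e + 3 * k) <= 44 * k)%N.
    by rewrite /e -mulnn; clear -k0; lia.
  by rewrite -!exprD; apply: ler_weXn2l; [exact: L1 | exact: ee].
have h1i : h1 \is a polyOver Num.int_num_subdef.
  apply: ih1 => // j; rewrite -mul_polyC; apply: rpredM; first by rewrite polyOverC ui.
  exact: half_power_jet_int.
have sh1' : (size h1 <= #|'I_3| * k)%N.
  rewrite card_ord; apply/leq_sizeP => i i3.
  have E : h1`_i = h2`_i.
    have := congr1 (fun p : {poly R} => p`_i) h12.
    rewrite !coefB coefZ [T`_i]nth_default ?(leq_trans sT) // mulr0 subr0 coef0.
    by move/eqP; rewrite subr_eq0 => /eqP.
  have i1 : h1`_i \is a Num.int := polyOverP h1i i.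
  apply/eqP/negPn/negP => n0.
  have := norm_intr_ge1 i1 n0; rewrite E => /le_trans/(_ (coef_le_pnorm h2 i)).
  by rewrite leNgt h2small.
have := @half_power_interpolant_degree R _ a k N (fun j => D * u j) h1 ainj _ sh1' _ j0.
move=> H; have/eqP : D * u j0 = 0.
  apply: H => [j|j].
    apply/negP => /eqP E; have := al j.
    have -> : a j = - N by lra.
    by rewrite normrN gtr0_norm //; lra.
  by rewrite -scalerA -comp_polyZ; exact: ch1.
by rewrite mulf_eq0 (negPf D0) (negPf uj0).
Qed.

(** * Large gaps between the elements of a quadruple *)

(** As [g c + n], [g d + n] and [c d + n] are squares, the square of
    [s x / (g z)] is nearly [1 + n / (g c)]; a difference of two squares bounds the
    distance from [s x] to [g z sqrt (1 + n / (g c))] by about [|n| sqrt (c / d)]. *)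
Lemma sqrt_approx_of_squares (R : realType) (g c d n s x z : R) (e : nat) :
  1 <= g -> g <= c -> c <= d -> 2 * `|n| <= c -> c ^+ (2 * e).+1 <= d ->
  0 <= s -> 0 <= x -> 0 <= z ->
  g * c + n = s ^+ 2 -> g * d + n = x ^+ 2 -> c * d + n = z ^+ 2 ->
  `|s * x - g * z * Num.sqrt (1 + n / (g * c))| <= 2 * `|n| / c ^+ e.
Proof.
move=> g1 gc cd nc cde s0 x0 z0 Es Ex Ez.
have n1 : n <= `|n| := ler_norm n; have n2 : - `|n| <= n by rewrite lerNl -normrN ler_norm.
have c1 : 1 <= c by lra.
have gcp : c <= g * c by nra.
have gdp : d <= g * d by nra.
set th := Num.sqrt _.
have gc0 : 0 < g * c by lra.
have th0 : 0 <= th := sqrtr_ge0 _.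
have th2 : th ^+ 2 * (g * c) = s ^+ 2.
  rewrite sqr_sqrtr; first by rewrite -Es; field; lra.
  have -> : 1 + n / (g * c) = s ^+ 2 / (g * c) by rewrite -Es; field; lra.
  by rewrite divr_ge0 ?exprn_ge0 // ltW.
have xp : 0 < x.
  rewrite lt0r x0 andbT; apply/eqP => xz.
  by move: Ex; rewrite xz expr0n /=; lra.
have key : (s * x - g * z * th) * (s * x + g * z * th) = s ^+ 2 * n * (1 - g / c).
  have -> : (s * x - g * z * th) * (s * x + g * z * th) =
     s ^+ 2 * x ^+ 2 - z ^+ 2 * g / c * (th ^+ 2 * (g * c)) by field; lra.
  by rewrite th2 -Ex -Ez; field; lra.
have b1 : `|s * x - g * z * th| * x <= s * `|n|.
  have [s_0|sn0] := eqVneq s 0.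
    have /eqP : th ^+ 2 * (g * c) = 0 by rewrite th2 s_0 expr0n.
    rewrite mulf_eq0 (gt_eqF gc0) orbF expf_eq0 /= => /eqP ->.
    by rewrite s_0 !mul0r mulr0 subrr normr0 mul0r.
  have sp : 0 < s by rewrite lt0r sn0.
  rewrite -(ler_pM2l sp).
  have h1 : `|s * x - g * z * th| * (s * x + g * z * th) <= s ^+ 2 * `|n|.
    have p0 : 0 <= s * x + g * z * th by rewrite addr_ge0 ?mulr_ge0 //; lra.
    rewrite -{1}(ger0_norm p0) -normrM key !normrM (ger0_norm s0) -expr2.
    have : `|1 - g / c| <= 1.
      have gc1 : 0 <= g / c <= 1 by rewrite divr_ge0 ?ler_pdivrMr; lra.
      by rewrite ger0_norm; lra.
    have : 0 <= s ^+ 2 * `|n| by rewrite mulr_ge0 ?exprn_ge0.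
    by move=> P Q; rewrite ler_piMr.
  apply: le_trans (le_trans h1 _); last by rewrite expr2; lra.
  have -> : s * (`|s * x - g * z * th| * x) = `|s * x - g * z * th| * (s * x) by ring.
  by rewrite ler_wpM2l // lerDl ?mulr_ge0 //; lra.
have ce0 : 0 < c ^+ e by rewrite exprn_gt0 //; lra.
have b2 : s * c ^+ e <= 2 * x.
  have : (s * c ^+ e) ^+ 2 <= (2 * x) ^+ 2.
    rewrite exprMn -Es [(2 * x) ^+ 2]exprMn -Ex -exprM mulnC.
    have h1 : g * c + n <= 3 / 2 * (g * c) by lra.
    have h2 : 2 * (g * d) <= 2 ^+ 2 * (g * d + n) by rewrite expr2; lra.
    have w0 : 0 <= c ^+ (2 * e) by rewrite exprn_ge0 // (le_trans ler01).
    have h1w := ler_wpM2r w0 h1.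
    rewrite exprS in cde; move: cde h1w; set w := c ^+ _ => cde h1w.
    have A : g * (c * w) <= g * d by rewrite ler_wpM2l // (le_trans ler01).
    have B : 0 <= g * d by apply: le_trans gdp; apply: le_trans cd; apply: le_trans c1.
    apply: le_trans h1w _; apply: le_trans h2.
    have -> : 3 / 2 * (g * c) * w = 3 / 2 * (g * (c * w)) by ring.
    by clear -A B; move: (g * (c * w)) (g * d) A B => v u; lra.
  by rewrite ler_sqr ?nnegrE ?mulr_ge0 // ltW.
rewrite ler_pdivlMr // -(ler_pM2r xp).
have -> : `|s * x - g * z * th| * c ^+ e * x = `|s * x - g * z * th| * x * c ^+ e by ring.
apply: le_trans (ler_wpM2r (ltW ce0) b1) _.
have -> : s * `|n| * c ^+ e = `|n| * (s * c ^+ e) by ring.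
have -> : 2 * `|n| * x = `|n| * (2 * x) by ring.
by rewrite ler_wpM2l.
Qed.

Lemma card3_uniq_injective (T : eqType) (a : 'I_3 -> T) :
  a (inord 0) != a (inord 1) -> a (inord 0) != a (inord 2) ->
  a (inord 1) != a (inord 2) -> injective a.
Proof.
move=> h01 h02 h12 i j.
have H (l : 'I_3) : [\/ l = inord 0, l = inord 1 | l = inord 2].
  case: l => [[|[|[|//]]] hl]; [apply: Or31|apply: Or32|apply: Or33];
  by apply/val_inj; rewrite /= inordK.
by case: (H i) => ->; case: (H j) => -> // /eqP;
  rewrite ?(negPf h01) ?(negPf h02) ?(negPf h12) // eq_sym
    ?(negPf h01) ?(negPf h02) ?(negPf h12).
Qed.

Lemma exp_bracket (R : realType) (c d : R) (p q : nat) : 2 <= c ->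
  c ^+ (p * 2 + q) <= d -> (0 < p)%N ->
  exists m, [/\ (2 <= m)%N, c ^+ (p * m + q) <= d & d <= c ^+ (p * m.+1 + q)].
Proof.
move=> c2 h2 p0.
have c1 : 1 <= c by lra.
have mono i j : (i <= j)%N -> c ^+ (p * i + q) <= c ^+ (p * j + q).
  by move=> ij; rewrite ler_weXn2l // leq_add2r leq_mul2l ij orbT.
have ex : exists m, d < c ^+ (p * m + q).
  exists (Num.bound d); apply: (@lt_le_trans _ _ (Num.bound d)%:R).
    by apply: archi_boundP; apply: le_trans h2; rewrite exprn_ge0 //; lra.
  apply: (@le_trans _ _ (2 ^+ Num.bound d)).
    by rewrite -natrX ler_nat ltnW // ltn_expl.
  apply: (@le_trans _ _ (c ^+ Num.bound d)).
    by rewrite lerXn2r ?nnegrE //; lra.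
  by rewrite ler_weXn2l // (leq_trans _ (leq_addr _ _)) // leq_pmull.
have := ex_minnP ex; case=> m dm mmin.
have m3 : (2 < m)%N.
  rewrite ltnNge; apply/negP => /mono H.
  by move: (lt_le_trans dm (le_trans H h2)); rewrite ltxx.
case: m m3 dm mmin => // m m2 dm mmin; exists m; split => //; last exact: ltW.
by rewrite leNgt; apply/negP => /mmin; rewrite ltnn.
Qed.

(** [sqrt_simultaneous] for the nodes [0, b n, a n] and [N = a b c], where
    [1 + b n / N = 1 + n / (a c)] and [1 + a n / N = 1 + n / (b c)] are nearly
    squares of rationals with denominators [a z] and [b z].  The degree [k] is
    adapted to [d]: if [d] lies between [c ^ (22 m + 3)] and [c ^ (22 m + 25)],
    take [k = 10 m].  The approximation error is then about [c ^ - (11 m + 1)]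
    against [N ^ k], and [z] is at most [c ^ (19 m - 1)] against [N ^ (2 k)]; the
    remaining [c ^ m] absorbs all powers of [L] as [c >= L ^ 490].  The choice is
    possible from [m = 2] on, that is, from [d >= c ^ 47] on. *)
Lemma large_gap (R : realType) (a b c d n s t x y z : R) :
  (forall v, v \in [:: a; b; c; n; s; t; x; y; z] -> v \is a Num.int) ->
  (forall v, v \in [:: s; t; x; y; z] -> 0 <= v) ->
  n != 0 -> 1 <= a -> a < b -> (1 + b * `|n|) ^+ 490 <= c -> c ^+ 47 <= d ->
  a * c + n = s ^+ 2 -> b * c + n = t ^+ 2 ->
  a * d + n = x ^+ 2 -> b * d + n = y ^+ 2 -> c * d + n = z ^+ 2 -> False.
Proof.
move=> ints nneg n0 a1 ab cL dc Es Et Ex Ey Ez.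
have [ai bi] : a \is a Num.int /\ b \is a Num.int.
  by split; apply: ints; rewrite !inE eqxx ?orbT.
have [ci ni] : c \is a Num.int /\ n \is a Num.int.
  by split; apply: ints; rewrite !inE eqxx ?orbT.
have [si ti] : s \is a Num.int /\ t \is a Num.int.
  by split; apply: ints; rewrite !inE eqxx ?orbT.
have [xi yi] : x \is a Num.int /\ y \is a Num.int.
  by split; apply: ints; rewrite !inE eqxx ?orbT.
have zi : z \is a Num.int by apply: ints; rewrite !inE eqxx ?orbT.
have [s0 t0] : 0 <= s /\ 0 <= t by split; apply: nneg; rewrite !inE eqxx ?orbT.
have [x0 y0] : 0 <= x /\ 0 <= y by split; apply: nneg; rewrite !inE eqxx ?orbT.
have z0 : 0 <= z by apply: nneg; rewrite !inE eqxx ?orbT.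
clear ints nneg.
have n1 : 1 <= `|n| := norm_intr_ge1 ni n0.
have [L LE] : exists L, L = 1 + b * `|n| by eexists.
rewrite -LE in cL.
have bn : b <= b * `|n| by rewrite ler_peMr //; lra.
have nb : `|n| <= b * `|n| by rewrite ler_peMl //; lra.
have L2 : 2 <= L by rewrite LE; clear -n1 bn nb a1 ab; lra.
have L1 : 1 <= L by apply: le_trans L2; rewrite ler1n.
have bL : b <= L by rewrite LE; clear -bn; lra.
have L0 : 0 <= L by apply: le_trans L1.
have LX i j : (i <= j)%N -> L ^+ i <= L ^+ j by exact: ler_weXn2l.
have L2c : L ^+ 2 <= c by apply: le_trans cL; apply: LX.
have Lc : 2 * L <= L ^+ 2 by rewrite expr2 ler_wpM2r.
have c4 : 4 <= c by clear -L2c Lc L2; lra.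
have [|m [m2 dlo dhi]] := @exp_bracket R c d 22 3 _ dc isT; first by clear -c4; lra.
have c1 : 1 <= c by clear -c4; lra.
have c0 : 0 < c by clear -c4; lra.
have cX i j : (i <= j)%N -> c ^+ i <= c ^+ j by exact: ler_weXn2l.
have cd : c <= d by apply: le_trans dc; rewrite -{1}[c]expr1; apply: cX.
have Lm : L ^+ (490 * m) <= c ^+ m.
  by rewrite exprM; apply: lerXn2r; rewrite // nnegrE ?exprn_ge0 // ltW.
clear cL dc.
have bc : b <= c by clear -bL Lc L2c L2; lra.
have d1 : 1 <= d by exact: le_trans c1 cd.
have ccd : c <= c * d by apply: ler_peMr d1; exact: ltW.
have ap : 0 < a by clear -a1; lra.
have bp : 0 < b by clear -ap ab; lra.
have nc : 2 * `|n| <= c by clear -LE Lc L2c nb; lra.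
have [k kE] : exists k, k = (10 * m)%N by eexists.
have [e eE] : exists e, e = (11 * m + 1)%N by eexists.
have [f fE] : exists f, f.+1 = (19 * m)%N by exists (19 * m).-1; clear -m2; lia.
have dlo' : c ^+ (2 * e).+1 <= d by apply: le_trans dlo; apply: cX; clear -eE; lia.
have A1 := @sqrt_approx_of_squares R a c d n s x z e a1 (ltW (lt_le_trans ab bc)) cd nc
  dlo' s0 x0 z0 Es Ex Ez.
have A2 := @sqrt_approx_of_squares R b c d n t y z e (le_trans a1 (ltW ab)) bc cd nc
  dlo' t0 y0 z0 Et Ey Ez.
have zf : z <= c ^+ f.
  rewrite -(@ler_pXn2r _ 2) ?nnegrE ?exprn_ge0 ?(ltW c0) // -Ez -exprM.
  have h1 : c * d + n <= 2 * (c * d).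
    by have := ler_norm n; move: ccd; clear -nc c0; move: (c * d) => v; lra.
  apply: le_trans h1 _; apply: (@le_trans _ _ (c * (c * c ^+ (22 * m.+1 + 3)))).
    apply: ler_pM => //; first by rewrite mulr_ge0 // ltW // (lt_le_trans c0 cd).
      by clear -c4; lra.
    by rewrite ler_wpM2l // ltW.
  by rewrite -!exprS; apply: cX; clear -fE m2; lia.
pose N := a * b * c.
pose nd : 'I_3 -> R := fun j => [:: 0; b * n; a * n]`_j.
pose u : 'I_3 -> R := fun j => [:: a * b * z; b * (s * x); a * (t * y)]`_j.
have b1 : 1 <= b by clear -a1 ab; lra.
have cN : c <= N by rewrite /N ler_peMl ?(ltW c0) // mulr_ege1.
have N0 : 0 < N by exact: lt_le_trans cN.
have aL : a <= L by exact: le_trans (ltW ab) bL.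
have NL : N <= L ^+ 2 * c.
  by rewrite /N ler_wpM2r ?(ltW c0) // expr2 ler_pM // ltW.
have zp : 0 < z.
  rewrite lt0r z0 andbT; apply/eqP => z_0; move: Ez; rewrite z_0 expr0n /=.
  have : - `|n| <= n by rewrite lerNl -normrN ler_norm.
  move: ccd; clear -nc c4; move: (c * d) => v; lra.
have an_ : `|a * n| <= b * `|n|.
  by rewrite normrM ler_wpM2r // gtr0_norm // ltW.
have bn_ : `|b * n| = b * `|n| by rewrite normrM gtr0_norm.
have abn : `|b * n - a * n| <= b * `|n|.
  by rewrite -mulrBl normrM ler_wpM2r // ger0_norm; clear -ab ap; lra.
have := @sqrt_simultaneous R nd N L (a * b * z) (2 * b * `|n| / c ^+ e) k u.
have ndinj : injective nd.
  apply: card3_uniq_injective; rewrite /nd !inordK //=.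
  - by rewrite eq_sym mulf_eq0 (negPf n0) orbF gt_eqF.
  - by rewrite eq_sym mulf_eq0 (negPf n0) orbF gt_eqF.
  - by rewrite (inj_eq (mulIf n0)) gt_eqF.
move/(_ ndinj).
have ndi j : nd j \is a Num.int.
  by case: j => [[|[|[|//]]] hj]; rewrite /nd /= ?rpred0 // rpredM.
have ui j : u j \is a Num.int.
  by case: j => [[|[|[|//]]] hj]; rewrite /u /= ?rpredM.
have Ni : N \is a Num.int by rewrite /N !rpredM.
have uex : exists j, u j != 0.
  by exists ord0; rewrite /u /=; apply: mulf_neq0; [apply: mulf_neq0|]; rewrite gt_eqF.
move/(_ ndi Ni ui uex L2).
have ndL j : 1 + `|nd j| <= L.
  case: j => [[|[|[|//]]] hj]; rewrite /nd /= ?normr0 LE ?bn_; clear -an_ nb n1; lra.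
have nddL i j : 1 + `|nd i - nd j| <= L.
  case: i => [[|[|[|//]]] hi]; case: j => [[|[|[|//]]] hj]; rewrite /nd /=
    ?subrr ?sub0r ?subr0 ?normr0 ?normrN ?bn_ LE; try (by clear -an_ abn nb n1; lra).
  by rewrite distrC; clear -abn; lra.
have LN : 2 * L <= N by exact: le_trans Lc (le_trans L2c cN).
have k0 : (0 < k)%N by clear -kE m2; lia.
move/(_ ndL nddL LN k0).
have ce0 : 0 < c ^+ e by rewrite exprn_gt0.
have uerr j : `|u j - a * b * z * Num.sqrt (1 + nd j / N)| <= 2 * b * `|n| / c ^+ e.
  case: j => [[|[|[|//]]] hj]; rewrite /u /nd /=.
  - rewrite mul0r addr0 sqrtr1 mulr1 subrr normr0 divr_ge0 ?mulr_ge0 // ltW //.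
  - have -> : b * n / N = n / (a * c) by rewrite /N; field; rewrite !gt_eqF.
    have -> : b * (s * x) - a * b * z * Num.sqrt (1 + n / (a * c)) =
      b * (s * x - a * z * Num.sqrt (1 + n / (a * c))) by ring.
    rewrite normrM (gtr0_norm bp).
    have -> : 2 * b * `|n| / c ^+ e = b * (2 * `|n| / c ^+ e) by ring.
    by rewrite ler_wpM2l // ltW.
  - have -> : a * n / N = n / (b * c) by rewrite /N; field; rewrite !gt_eqF.
    have -> : a * (t * y) - a * b * z * Num.sqrt (1 + n / (b * c)) =
      a * (t * y - b * z * Num.sqrt (1 + n / (b * c))) by ring.
    rewrite normrM (gtr0_norm ap).
    have -> : 2 * b * `|n| / c ^+ e = b * (2 * `|n| / c ^+ e) by ring.
    by rewrite ler_pM ?normr_ge0 // ltW.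
move/(_ uerr).
have T1 : L ^+ (44 * k) * (2 * b * `|n| / c ^+ e * N ^+ k) <= c^-1.
  have h1 : 2 * b * `|n| <= L ^+ 2.
    by apply: le_trans Lc; rewrite -mulrA ler_wpM2l // LE lerDr.
  have h2 : N ^+ k <= L ^+ (2 * k) * c ^+ k.
    rewrite exprM -exprMn lerXn2r ?nnegrE ?mulr_ge0 ?exprn_ge0 //; exact: ltW.
  have -> : L ^+ (44 * k) * (2 * b * `|n| / c ^+ e * N ^+ k) =
     L ^+ (44 * k) * ((2 * b * `|n|) * N ^+ k) / c ^+ e by ring.
  rewrite ler_pdivrMr //.
  have -> : c^-1 * c ^+ e = c ^+ m * c ^+ k.
    by rewrite -exprD eE addn1 exprS mulKf ?gt_eqF //; congr (_ ^+ _); clear -kE; lia.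
  have h3 := ler_pM (mulr_ge0 (mulr_ge0 (ler0n R 2) (ltW bp)) (normr_ge0 n))
    (exprn_ge0 k (ltW N0)) h1 h2.
  apply: le_trans (ler_wpM2l (exprn_ge0 _ L0) h3) _.
  have -> : L ^+ (44 * k) * (L ^+ 2 * (L ^+ (2 * k) * c ^+ k)) =
    L ^+ (44 * k + (2 + 2 * k)) * c ^+ k by rewrite [in RHS]exprD [L ^+ (2 + _)]exprD !mulrA.
  rewrite ler_wpM2r ?exprn_ge0 ?(ltW c0) //.
  by apply: le_trans Lm; apply: LX; clear -kE m2; lia.
have T2 : L ^+ (44 * k) * (`|a * b * z| / N ^+ (2 * k)) <= c^-1.
  have h1 : `|a * b * z| <= L ^+ 2 * c ^+ f.
    rewrite gtr0_norm ?mulr_gt0 // expr2 ler_pM ?ler_pM ?mulr_ge0 // ltW //.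
  have h2 : c ^+ (2 * k) <= N ^+ (2 * k) by rewrite lerXn2r ?nnegrE ?(ltW N0) ?(ltW c0).
  rewrite mulrA ler_pdivrMr ?exprn_gt0 //.
  apply: le_trans (ler_wpM2l _ h2); last by rewrite invr_ge0 ltW.
  have -> : c^-1 * c ^+ (2 * k) = c ^+ m * c ^+ f.
    have -> : (2 * k = (m + f).+1)%N by clear -kE fE m2; lia.
    by rewrite exprS mulKf ?gt_eqF // exprD.
  apply: le_trans (ler_wpM2l (exprn_ge0 _ L0) h1) _.
  have -> : L ^+ (44 * k) * (L ^+ 2 * c ^+ f) = L ^+ (44 * k + 2) * c ^+ f.
    by rewrite exprD mulrA.
  rewrite ler_wpM2r ?exprn_ge0 ?(ltW c0) //.
  by apply: le_trans Lm; apply: LX; clear -kE m2; lia.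
rewrite mulrDr => T; have := le_trans T (lerD T1 T2).
have : c^-1 <= 4^-1 by rewrite lef_pV2 ?posrE.
by clear; lra.
Qed.

(** * The gap principle *)

(** Hence [a b + n] differs from [a b] by a sixth at most, so that the square
    roots in [triple_gap] can be compared with the products. *)
Lemma six_norm_le (n a b : int) : n ^+ 2 < a -> a < b -> 6 * `|n| <= a * b.
Proof.
rewrite -[n ^+ 2]real_normK ?num_real //; move: `|n| (normr_ge0 n) => m m0 ma ab.
have h1 : m ^+ 2 + 1 <= a by lia.
have h2 : m ^+ 2 + 2 <= b by lia.
have h3 : 2 * m <= m ^+ 2 + 1.
  by rewrite -subr_ge0 (_ : _ - _ = (m - 1) ^+ 2) ?sqr_ge0 //; ring.
have [->|mn0] := eqVneq m 0; first by rewrite mulr0 mulr_ge0 //; lia.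
have h4 : 3 <= m ^+ 2 + 2 by nia.
apply: le_trans (ler_pM _ _ (le_trans h3 h1) (le_trans h4 h2)); lia.
Qed.

(** For [e = n (a + b + c) + 2 a b c - 2 r s t], the number [a e + n ^ 2] is the
    square of [a t - r s], so that [e >= 0] as soon as [a > n ^ 2].  Moreover
    [e (e + 4 r s t) = n ^ 2 ((c - a - b) ^ 2 - 4 r ^ 2)]: the first disjunct comes
    from [e > 0], the second from [e = 0]. *)
Lemma triple_gap (n a b c r s t : int) : n != 0 -> n ^+ 2 < a -> a < b -> b < c ->
  0 <= r -> 0 <= s -> 0 <= t ->
  a * b + n = r ^+ 2 -> a * c + n = s ^+ 2 -> b * c + n = t ^+ 2 ->
  3 * (a * b) <= n ^+ 2 * c \/ (c - a - b) ^+ 2 = 4 * r ^+ 2.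
Proof.
move=> n0 na ab bc r0 s0 t0 Er Es Et.
have a0 : 0 < a by apply: le_lt_trans na; exact: sqr_ge0.
pose e := n * (a + b + c) + 2 * (a * b * c) - 2 * (r * s * t).
have ea : a * e = (a * t - r * s) ^+ 2 - n ^+ 2.
  have -> : (a * t - r * s) ^+ 2 =
    a ^+ 2 * t ^+ 2 + r ^+ 2 * s ^+ 2 - 2 * a * (r * s * t) by ring.
  by rewrite -Er -Es -Et /e; ring.
have e0 : 0 <= e.
  rewrite leNgt; apply/negP => eneg.
  have : a * e <= a * (-1) by rewrite ler_pM2l //; lia.
  by rewrite ea; have := sqr_ge0 (a * t - r * s); lia.
have fact : e * (e + 4 * (r * s * t)) = n ^+ 2 * ((c - a - b) ^+ 2 - 4 * r ^+ 2).
  have -> : e * (e + 4 * (r * s * t)) =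
    (n * (a + b + c) + 2 * (a * b * c)) ^+ 2 - 4 * (r ^+ 2 * s ^+ 2 * t ^+ 2).
    by rewrite /e; ring.
  by rewrite -Er -Es -Et; ring.
have [e_0|en0] := eqVneq e 0.
  right; move/eqP: fact; rewrite e_0 mul0r eq_sym mulf_eq0 expf_eq0 (negPf n0) /=.
  by rewrite subr_eq0 => /eqP.
left.
have rst0 : 0 <= r * s * t by rewrite !mulr_ge0.
have h1 : 4 * (r * s * t) <= n ^+ 2 * c ^+ 2.
  apply: (@le_trans _ _ (e * (e + 4 * (r * s * t)))).
    have e1 : 1 <= e by lia.
    move: rst0 e1; clear; move: (r * s * t) => Y Y0 e1.
    by apply: (@le_trans _ _ (1 * (e + 4 * Y))); [lia | rewrite ler_wpM2r //; lia].
  rewrite fact ler_wpM2l ?sqr_ge0 //.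
  have : (c - a - b) ^+ 2 <= c ^+ 2.
    rewrite -subr_ge0 (_ : _ - _ = (a + b) * (2 * c - a - b)); last by ring.
    by rewrite mulr_ge0 //; clear -ab bc a0; lia.
  by apply: le_trans; rewrite gerBl mulr_ge0 ?sqr_ge0.
have k1 := six_norm_le na ab.
have k2 := six_norm_le na (lt_trans ab bc).
have k3 : 6 * `|n| <= b * c by apply: six_norm_le bc; apply: lt_trans ab.
have n2 : - `|n| <= n by rewrite lerNl -normrN ler_norm.
have h2 : 3 * (a * b * c) <= 4 * (r * s * t).
  have q r' p : 6 * `|n| <= p -> p + n = r' ^+ 2 -> 5 * p <= 6 * r' ^+ 2.
    by clear -n2 => h <-; lra.
  have [p1 p2 p3] : [/\ 0 <= a * b, 0 <= a * c & 0 <= b * c].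
    by clear -a0 ab bc; split; apply: mulr_ge0; lia.
  clear fact ea.
  have := ler_pM (mulr_ge0 (mulr_ge0 (ler0n _ 5) p1) (mulr_ge0 (ler0n _ 5) p2))
    (mulr_ge0 (ler0n _ 5) p3)
    (ler_pM (mulr_ge0 (ler0n _ 5) p1) (mulr_ge0 (ler0n _ 5) p2) (q _ _ k1 Er) (q _ _ k2 Es))
    (q _ _ k3 Et).
  have -> : 5 * (a * b) * (5 * (a * c)) * (5 * (b * c)) = 125 * (a * b * c) ^+ 2 by ring.
  have -> : 6 * r ^+ 2 * (6 * s ^+ 2) * (6 * t ^+ 2) = 216 * (r * s * t) ^+ 2 by ring.
  have : 0 <= a * b * c by rewrite mulr_ge0 //; clear -a0 ab bc; lia.
  move: rst0; clear; move: (r * s * t) (a * b * c) => Y X Y0 X0 XY.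
  rewrite leNgt; apply/negP => lt43.
  have : (4 * Y) ^+ 2 < (3 * X) ^+ 2 by rewrite ltr_pXn2r ?nnegrE ?mulr_ge0.
  rewrite !exprMn; lia.
have c0 : 0 < c by clear -a0 ab bc; lia.
rewrite -(ler_pM2r c0); apply: le_trans (le_trans _ h2) (le_trans h1 _).
  by rewrite !mulrA.
by rewrite expr2 mulrA.
Qed.

(** Gap principle.  If the second alternative of [triple_gap] held for both
    [(a, c, d)] and [(b, c, d)], then [d = a + c + 2 s = b + c + 2 t], although
    [a < b] and [s < t]. *)
Lemma quadruple_gap (n a b c d s t x y z : int) :
  n != 0 -> n ^+ 2 < a -> a < b -> b < c -> c < d ->
  0 <= s -> 0 <= t -> 0 <= x -> 0 <= y -> 0 <= z ->
  a * c + n = s ^+ 2 -> b * c + n = t ^+ 2 ->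
  a * d + n = x ^+ 2 -> b * d + n = y ^+ 2 -> c * d + n = z ^+ 2 ->
  3 * (a * c) <= n ^+ 2 * d.
Proof.
move=> n0 na ab bc cd s0 t0 x0 y0 z0 Es Et Ex Ey Ez.
have a0 : 0 < a by apply: le_lt_trans na; exact: sqr_ge0.
have c0 : 0 < c by lia.
case: (triple_gap n0 na (lt_trans ab bc) cd s0 x0 z0 Es Ex Ez) => // A.
case: (triple_gap n0 (lt_trans na ab) bc cd t0 y0 z0 Et Ey Ez) => [B|B].
  by apply: le_trans B; rewrite ler_pM2l // ler_pM2r // ltW.
have n2 : - `|n| <= n by rewrite lerNl -normrN ler_norm.
have root g w : n ^+ 2 < g -> g < c -> 0 <= w -> g * c + n = w ^+ 2 ->
    (d - g - c) ^+ 2 = 4 * w ^+ 2 -> d = g + c + 2 * w.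
  move=> ng gc w0 Ew /eqP.
  have -> : 4 * w ^+ 2 = (2 * w) ^+ 2 by ring.
  rewrite eqf_sqr => /orP[/eqP E|/eqP E]; first by clear -E; lia.
  have g2 : 2 * w < g by clear -E cd; lia.
  have : (2 * w) ^+ 2 < g ^+ 2 by rewrite ltr_pXn2r ?nnegrE //; clear -w0 g2; lia.
  have -> : (2 * w) ^+ 2 = 4 * w ^+ 2 by ring.
  have gg : g ^+ 2 < g * c by rewrite expr2 ltr_pM2l //; clear -ng; have := sqr_ge0 n; lia.
  move: gg (six_norm_le ng gc) (normr_ge0 n); rewrite -Ew; clear -n2.
  move: (g * c) (g ^+ 2) => u v; lra.
have D1 := root a s na (lt_trans ab bc) s0 Es A.
have D2 := root b t (lt_trans na ab) bc t0 Et B.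
have : s ^+ 2 < t ^+ 2 by rewrite -Es -Et ltrD2r ltr_pM2r.
by rewrite ltr_pXn2r ?nnegrE //; clear -D1 D2 ab; lia.
Qed.

(** * Growth along a chain of elements *)

Lemma counting_le (R : realType) (X : set nat) (B : R) :
  (forall w : seq nat, sorted ltn w -> {in w, forall a, X a} -> (size w)%:R <= B) ->
  (counting X <= B%:E)%E.
Proof.
move=> H.
have main (F : {fset nat}) : (forall a, a \in F -> X a) -> #|` F |%:R <= B.
  move=> FX; have := H (sort leq (enum_fset F)).
  rewrite size_sort; apply.
    by rewrite ltn_sorted_uniq_leq sort_uniq fset_uniq sort_sorted //; exact: leq_total.
  by move=> a; rewrite mem_sort; exact: FX.
rewrite /counting; case: asboolP => [fX|iX].
  by rewrite lee_fin; apply: main => a; rewrite in_fset_set // => /set_mem.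
have [F FX cF] := infinite_set_fset (Num.bound `|B|) iX.
have : #|` F |%:R <= B by apply: main => a aF; apply: FX.
move=> cB; have : `|B| < #|` F |%:R.
  by apply: lt_le_trans (archi_boundP (normr_ge0 B)) _; rewrite ler_nat.
by move=> /(le_lt_trans (le_trans cB (ler_norm B))); rewrite ltxx.
Qed.

Lemma diophantine_root (n : int) (S : set nat) (a b : nat) :
  diophantine_tuple n S -> S a -> S b -> (a < b)%N ->
  exists2 r : int, 0 <= r & a%:Z * b%:Z + n = r ^+ 2.
Proof.
move=> [_ H] Sa Sb ab; have [|k E] := H a b Sa Sb; first by move=> E; rewrite E ltnn in ab.
by exists `|k|; rewrite ?normr_ge0 // E real_normK ?num_real.
Qed.

Definition large_chain (n : int) (S : set nat) (w : seq nat) : Prop :=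
  sorted ltn w /\ {in w, forall a, S a /\ n ^+ 2 < a%:Z}.

(** In this normalization the gap principle reads [v_i v_(i+2) <= v_(i+3)], and
    [a > n ^ 2] reads [v > 3]. *)
Definition scaled (R : realType) (n : int) (w : seq nat) (i : nat) : R :=
  3 * (nth 0%N w i)%:R / (n ^+ 2)%:~R.

Lemma chain_lt (n : int) (S : set nat) (w : seq nat) i j :
  large_chain n S w -> (i < j)%N -> (j < size w)%N -> (nth 0%N w i < nth 0%N w j)%N.
Proof.
move=> [sw _] ij js; apply: (sorted_ltn_nth ltn_trans) => //.
by rewrite inE (ltn_trans ij).
Qed.

Lemma chain_mem (n : int) (S : set nat) (w : seq nat) i :
  large_chain n S w -> (i < size w)%N ->
  S (nth 0%N w i) /\ n ^+ 2 < (nth 0%N w i)%:Z.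
Proof. by move=> [_ H] iw; apply: H; exact: mem_nth. Qed.

Lemma scaled_le (R : realType) (n : int) (S : set nat) (w : seq nat) i j :
  large_chain n S w -> (i <= j)%N -> (j < size w)%N ->
  scaled R n w i <= scaled R n w j.
Proof.
move=> H ij js; rewrite /scaled ler_wpM2r ?invr_ge0 ?ler0z ?sqr_ge0 //.
rewrite ler_wpM2l // ler_nat; move: ij; rewrite leq_eqVlt => /orP[/eqP -> //|ij].
by apply: ltnW; exact: chain_lt H ij js.
Qed.

Lemma scaled_gt3 (R : realType) (n : int) (S : set nat) (w : seq nat) i :
  n != 0 -> large_chain n S w -> (i < size w)%N -> 3 < scaled R n w i.
Proof.
move=> n0 H iw; have [_ h] := chain_mem H iw.
have n2 : 0 < (n ^+ 2)%:~R :> R by rewrite ltr0z exprn_even_gt0.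
rewrite /scaled ltr_pdivlMr // ltr_pM2l //.
by move: h; rewrite -(ltr_int R).
Qed.

Lemma scaled_gap (R : realType) (n : int) (S : set nat) (w : seq nat) i :
  n != 0 -> diophantine_tuple n S -> large_chain n S w -> (i.+3 < size w)%N ->
  scaled R n w i * scaled R n w i.+2 <= scaled R n w i.+3.
Proof.
move=> n0 dS H i3.
have i2 : (i.+2 < size w)%N by exact: ltnW.
have i1 : (i.+1 < size w)%N by exact: ltnW.
have i0 : (i < size w)%N by exact: ltnW.
have [Sa na] := chain_mem H i0; have [Sb _] := chain_mem H i1.
have [Sc _] := chain_mem H i2; have [Sd _] := chain_mem H i3.
have ab := chain_lt H (ltnSn i) i1; have bc := chain_lt H (ltnSn _) i2.
have cd := chain_lt H (ltnSn _) i3.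
have ac := ltn_trans ab bc; have bd := ltn_trans bc cd; have ad := ltn_trans ab bd.
have [s s0 Es] := diophantine_root dS Sa Sc ac.
have [t t0 Et] := diophantine_root dS Sb Sc bc.
have [x x0 Ex] := diophantine_root dS Sa Sd ad.
have [y y0 Ey] := diophantine_root dS Sb Sd bd.
have [z z0 Ez] := diophantine_root dS Sc Sd cd.
have := quadruple_gap n0 na _ _ _ s0 t0 x0 y0 z0 Es Et Ex Ey Ez.
rewrite !ltz_nat => /(_ ab bc cd); rewrite -(ler_int R).
rewrite (intrM R 3) (intrM R (Posz _)) (intrM R (n ^+ 2)) => G.
have n2 : 0 < (n ^+ 2)%:~R :> R by rewrite ltr0z exprn_even_gt0.
rewrite /scaled; move: ((n ^+ 2)%:~R : R) n2 G => N n2.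
move: (nth _ _ i) (nth _ _ i.+2) (nth _ _ i.+3) => a c d.
rewrite -![(Posz _)%:~R]/(_%:R); move: (a%:R : R) (c%:R : R) (d%:R : R) => {}a {}c {}d G.
have -> : 3 * a / N * (3 * c / N) = 3 * (3 * (a * c)) / N ^+ 2.
  by field; rewrite gt_eqF.
have -> : 3 * d / N = 3 * (N * d) / N ^+ 2 by field; rewrite gt_eqF.
by rewrite ler_pM2r ?invr_gt0 ?exprn_gt0 // ler_pM2l //; exact: G.
Qed.

(** Since the sequence increases, three steps square it. *)
Lemma scaled_pow (R : realType) (n : int) (S : set nat) (w : seq nat) i j :
  n != 0 -> diophantine_tuple n S -> large_chain n S w -> (i + 3 * j < size w)%N ->
  scaled R n w i ^+ (2 ^ j) <= scaled R n w (i + 3 * j).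
Proof.
move=> n0 dS H; elim: j => [|j IH] h; first by rewrite muln0 addn0 expr1.
have E : (i + 3 * j.+1 = (i + 3 * j).+3)%N by lia.
rewrite E in h *; rewrite expnSr exprM.
have h0 : (i + 3 * j < size w)%N by lia.
have i0 : (i < size w)%N by apply: leq_ltn_trans h0; exact: leq_addr.
have v0 : 0 <= scaled R n w i ^+ (2 ^ j).
  by rewrite exprn_ge0 // ltW // (lt_trans _ (scaled_gt3 R n0 H i0)).
apply: le_trans (scaled_gap R n0 dS H h); rewrite expr2.
apply: ler_pM => //; first exact: IH.
by apply: le_trans (IH h0) _; apply: (scaled_le R H) => //; exact: ltnW.
Qed.

(** * Boundedly many very large elements *)

Lemma diophantine_large_gap (R : realType) (n : int) (S : set nat) (a b c d : nat) :
  diophantine_tuple n S -> n != 0 -> S a -> S b -> S c -> S d ->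
  (a < b < c)%N -> (c < d)%N ->
  (1 + b%:R * `|n|%:~R) ^+ 490 <= c%:R :> R -> c%:R ^+ 47 <= d%:R :> R -> False.
Proof.
move=> dS n0 Sa Sb Sc Sd /andP[ab bc] cd H1 H2.
have ac := ltn_trans ab bc; have bd := ltn_trans bc cd; have ad := ltn_trans ab bd.
have [s s0 Es] := diophantine_root dS Sa Sc ac.
have [t t0 Et] := diophantine_root dS Sb Sc bc.
have [x x0 Ex] := diophantine_root dS Sa Sd ad.
have [y y0 Ey] := diophantine_root dS Sb Sd bd.
have [z z0 Ez] := diophantine_root dS Sc Sd cd.
have real_eq (u v : nat) (r : int) : u%:Z * v%:Z + n = r ^+ 2 ->
    u%:R * v%:R + n%:~R = r%:~R ^+ 2 :> R.
  by move=> /(congr1 (intr : int -> R)); rewrite intrD (intrM R (Posz u)) rmorphXn.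
apply: (@large_gap R a%:R b%:R c%:R d%:R n%:~R s%:~R t%:~R x%:~R y%:~R z%:~R).
- by move=> v; rewrite !inE => /or4P[|||/or4P[|||/or3P[]]] /eqP ->;
    rewrite ?intr_int ?natr_int.
- by move=> v; rewrite !inE => /or4P[|||/orP[]] /eqP ->; rewrite ler0z.
- by rewrite intr_eq0.
- by rewrite ler1n; case: (dS) => H _; exact: H.
- by rewrite ltr_nat.
- by rewrite -intr_norm.
- exact: H2.
- exact: real_eq.
- exact: real_eq.
- exact: real_eq.
- exact: real_eq.
- exact: real_eq.
Qed.

(** Let [a], [b] be the elements of index [i] and [i + 1].  Three steps square
    [scaled], so [c], taken [3 * 10] steps after [b], exceeds the power [490] of
    [1 + b |n|], and [d], taken [3 * 7] steps after [c], exceeds [c ^ 47]: the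
    exponents [1024] and [128] leave room for the fact that an element is only
    bounded by the square of its scaled value. *)
Lemma chain_size_of_large (R : realType) (n : int) (S : set nat) (w : seq nat) (i : nat) :
  n != 0 -> diophantine_tuple n S -> large_chain n S w ->
  (3 * `|n|%:~R) ^+ 5 <= scaled R n w i -> (i < size w)%N -> (size w <= i + 52)%N.
Proof.
move=> n0 dS H big iw; rewrite leqNgt; apply/negP => sz.
pose ib := i.+1; pose ic := (ib + 3 * 10)%N; pose id_ := (ic + 3 * 7)%N.
have sd : (id_ < size w)%N by rewrite /id_ /ic /ib; lia.
have sc : (ic < size w)%N by apply: leq_ltn_trans sd; exact: leq_addr.
have sb : (ib < size w)%N by apply: leq_ltn_trans sc; exact: leq_addr.
set P : R := `|n|%:~R in big.
have P1 : 1 <= P by rewrite /P ler1z -gtz0_ge1 normr_gt0.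
have P2 : (n ^+ 2)%:~R = P ^+ 2 :> R.
  by rewrite /P -[n ^+ 2]real_normK ?num_real // rmorphXn.
have P0 : 0 < P by lra.
have vb3 := scaled_gt3 R n0 H sb; have vc3 := scaled_gt3 R n0 H sc.
have vb0 : 0 <= scaled R n w ib by apply: ltW; apply: lt_trans vb3.
have vc0 : 0 <= scaled R n w ic by apply: ltW; apply: lt_trans vc3.
have vbP : (3 * P) ^+ 5 <= scaled R n w ib.
  by apply: le_trans big _; apply: (scaled_le R H).
have vc : scaled R n w ib ^+ 1024 <= scaled R n w ic := scaled_pow R n0 dS H sc.
have vd : scaled R n w ic ^+ 128 <= scaled R n w id_ := scaled_pow R n0 dS H sd.
have elt k : (nth 0%N w k)%:R = scaled R n w k * P ^+ 2 / 3.
  by rewrite /scaled P2; field; rewrite gt_eqF.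
have eltge k v : 3 * v <= scaled R n w k -> 0 <= v -> v <= (nth 0%N w k)%:R.
  move=> h v0; rewrite elt; have : 1 <= P ^+ 2 by rewrite exprn_ege1.
  by move: h v0; clear; move: (scaled _ _ _ _) (P ^+ 2) => V Q h v0 Q1; nra.
have [Sa _] := chain_mem H iw; have [Sb _] := chain_mem H sb.
have [Sc _] := chain_mem H sc; have [Sd _] := chain_mem H sd.
have P35 : P ^+ 3 <= scaled R n w ib.
  apply: le_trans vbP; rewrite exprMn; apply: (@le_trans _ _ (P ^+ 5)).
    exact: ler_weXn2l.
  by rewrite ler_peMl ?exprn_ge0 ?(ltW P0) // exprn_ege1 // ler1n.
have bcn : (ib < ic)%N by rewrite /ic -[X in (X < _)%N]addn0 ltn_add2l.
have cdn : (ic < id_)%N by rewrite /id_ -[X in (X < _)%N]addn0 ltn_add2l.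
apply: (@diophantine_large_gap R n S _ _ _ _ dS n0 Sa Sb Sc Sd).
- by rewrite (chain_lt H (ltnSn i) sb) (chain_lt H bcn sc).
- exact: chain_lt H cdn sd.
- rewrite -/P; apply: (@le_trans _ _ ((scaled R n w ib ^+ 2) ^+ 490)).
    apply: lerXn2r; [by rewrite nnegrE addr_ge0 // mulr_ge0 ?ler0n // ltW
      | by rewrite nnegrE; exact: exprn_ge0 |].
    rewrite elt; move: vb3 P35; clear; move: (scaled _ _ _ _) => V V3 h.
    have -> : V * P ^+ 2 / 3 * P = V * P ^+ 3 / 3 by ring.
    by move: (P ^+ 3) h => Q h; nra.
  rewrite -exprM; apply: eltge; last by exact: exprn_ge0.
  apply: le_trans vc; have -> : 1024%N = (1 + (2 * 490 + 43))%N by [].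
  have V1 : 1 <= scaled R n w ib by apply: ltW; apply: lt_trans vb3; rewrite ltr1n.
  rewrite exprD expr1; apply: ler_pM => //; first by rewrite exprn_ge0 // (le_trans ler01).
    exact: ltW.
  by apply: ler_weXn2l => //; exact: leq_addr.
- apply: (@le_trans _ _ ((scaled R n w ic ^+ 2) ^+ 47)).
    apply: lerXn2r; [by rewrite nnegrE ler0n | by rewrite nnegrE; exact: exprn_ge0 |].
    have h : P ^+ 3 <= scaled R n w ic.
      by apply: le_trans P35 _; apply: (scaled_le R H) => //; exact: ltnW.
    have h2 : P ^+ 2 <= P ^+ 3 by exact: ler_weXn2l.
    rewrite elt; move: vc3 (le_trans h2 h); clear; move: (scaled _ _ _ _) => V V3 h.
    by move: (P ^+ 2) h => Q h; nra.
  rewrite -exprM; apply: eltge; last by exact: exprn_ge0.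
  apply: le_trans vd; have -> : 128%N = (1 + (2 * 47 + 33))%N by [].
  have V1 : 1 <= scaled R n w ic by apply: ltW; apply: lt_trans vc3; rewrite ltr1n.
  rewrite exprD expr1; apply: ler_pM => //; first by rewrite exprn_ge0 // (le_trans ler01).
    exact: ltW.
  by apply: ler_weXn2l => //; exact: leq_addr.
Qed.

(** * The two estimates *)

Lemma ln2_ge (R : realType) : 2^-1 <= ln 2 :> R.
Proof.
rewrite -ler_expR lnK ?posrE //.
have := expR_ge1Dx (- 2^-1 : R); rewrite expRN => h.
have e0 := expR_gt0 (2^-1 : R).
rewrite -[X in _ <= X]invrK -[X in X <= _]invrK lef_pV2 ?posrE ?invr_gt0 //.
by apply: le_trans h; lra.
Qed.

(** After [3 j] steps a scaled value of at least [3 |n| ^ eps] has become at least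
    [(3 |n| ^ eps) ^ (2 ^ j)], which reaches [(3 |n|) ^ 5] once [eps 2 ^ j >= 5]. *)
Lemma log2_steps (R : realType) (eps : R) : 0 < eps -> eps < 1 ->
  exists2 j, 5 <= eps * 2 ^+ j & j%:R <= 11 + 2 * ln (1 / eps).
Proof.
move=> e0 e1.
have ex : exists j, 5 <= eps * 2 ^+ j.
  exists (Num.bound (5 / eps)); rewrite mulrC -ler_pdivrMr //.
  apply: (@le_trans _ _ (Num.bound (5 / eps))%:R).
    by apply: ltW; apply: archi_boundP; rewrite divr_ge0 // ltW.
  by rewrite -natrX ler_nat ltnW // ltn_expl.
have := ex_minnP ex; case=> -[|j] jP jmin; first by move: jP; rewrite expr0; lra.
exists j.+1 => //.
have : ~~ (5 <= eps * 2 ^+ j) by apply/negP => /jmin; rewrite ltnn.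
rewrite -ltNge => lt5.
have : 2 ^+ j < 5 * (1 / eps) by rewrite mulrA mulr1 ltr_pdivlMr // mulrC.
move=> lt2; have e1' : 0 < 1 / eps by rewrite divr_gt0.
have : ln (2 ^+ j) < ln (5 * (1 / eps)).
  by rewrite ltr_ln // posrE ?exprn_gt0 // mulr_gt0.
rewrite lnXn // lnM ?posrE //.
have := @ln_sublinear R 5 (ltr0n R 5).
have := ler_wpM2l (ler0n R j) (ln2_ge R).
rewrite -[ln 2 *+ j]mulr_natl -[j.+1%:R]natr1.
by move: (ln (1 / eps)) (ln 5) (j%:R * ln 2) => x y z; lra.
Qed.

(** From index [9] on the scaled values exceed [3 ^ 8], so each step beyond index
    [11] multiplies them by at least [3 ^ 8]; as [8 ln 3 > 1 / 0.631], this is more than the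
    bound on [B] requires. *)
Lemma scaled_growth (R : realType) (n : int) (S : set nat) (w : seq nat) (m : nat) :
  n != 0 -> diophantine_tuple n S -> large_chain n S w -> (11 + m < size w)%N ->
  3 * 3 ^+ (8 * m) <= scaled R n w (11 + m).
Proof.
move=> n0 dS H; elim: m => [|m IH] sz.
  by rewrite expr0 mulr1 ltW // (scaled_gt3 R n0 H sz).
have h9 : (9 + m < size w)%N by apply: leq_ltn_trans sz; rewrite addnS leqW // leq_add2r.
have v9 : 3 ^+ 8 <= scaled R n w (9 + m).
  have s0 : (m < size w)%N by apply: leq_ltn_trans h9; exact: leq_addl.
  rewrite addnC; rewrite addnC in h9; apply: le_trans (scaled_pow R (j := 3) n0 dS H h9).
  apply: lerXn2r; rewrite ?nnegrE //; last by rewrite ltW // (scaled_gt3 R n0 H s0).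
  by rewrite ltW // (lt_trans _ (scaled_gt3 R n0 H s0)).
have E : (11 + m.+1 = (9 + m).+3)%N by rewrite !addSn addnS.
rewrite E in sz *; apply: le_trans (scaled_gap R n0 dS H sz).
have -> : 3 * 3 ^+ (8 * m.+1) = 3 ^+ 8 * (3 * 3 ^+ (8 * m)) :> R.
  by rewrite mulnS exprD mulrCA.
by apply: ler_pM => //; apply: IH; exact: ltnW.
Qed.

(* Every n and every eps in (0,1) satisfy A_sup n eps >= 3: for r large, the set
   {r^2 - n, (r+1)^2 - n, (2r+1)^2 - 4n} has the property D(n).  As log(1/eps)
   tends to 0 when eps tends to 1, O(log(1/eps)) on the whole of (0,1) is read
   as O(max(1, log(1/eps))). *)
Theorem theorem1p2 (R : realType) :
  (exists C : R, forall (eps : R) (n : int), 0 < eps -> eps < 1 -> n != 0 ->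
     (A_sup n eps <= (C * Num.max 1 (ln (1 / eps)))%:E)%E) /\
  (exists C : R, forall (eps : R) (n : int), 0 < eps -> eps < 1 -> n != 0 ->
     (B_sup n eps <= ((631%:R / 1000%:R) * eps * ln (`|n|%:~R) + C)%:E)%E).
Proof.
have norm1 (n : int) : n != 0 -> 1 <= `|n|%:~R :> R.
  by move=> n0; rewrite ler1z -gtz0_ge1 normr_gt0.
have sqrE (n : int) : (n ^+ 2)%:~R = `|n|%:~R ^+ 2 :> R.
  by rewrite -[n ^+ 2]real_normK ?num_real // rmorphXn.
have powE (n : int) (eps : R) : n != 0 ->
    `|n|%:~R `^ (2 + eps) = (n ^+ 2)%:~R * `|n|%:~R `^ eps :> R.
  move=> n0; have P1 := norm1 _ n0.
  have P0 : 0 < `|n|%:~R :> R by exact: lt_le_trans P1.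
  rewrite powRD; last by apply/implyP => _; rewrite gt_eqF.
  by rewrite sqrE -(powR_mulrn 2 (ltW P0)).
split.
(* The size is at most [3 j + 52] with [j <= 11 + 2 ln (1 / eps)]. *)
- exists 91 => eps n e0 e1 n0; apply: ge_ereal_sup => _ [S dS <-].
  apply: counting_le => w sw wX.
  have P1 := norm1 _ n0; set P : R := `|n|%:~R in P1.
  have n2 : 0 < (n ^+ 2)%:~R :> R by rewrite ltr0z exprn_even_gt0.
  have Pe1 : 1 <= P `^ eps by rewrite -(powRr0 P) ler_powR // ltW.
  have H : large_chain n S w.
    split=> // a /wX [Sa /=]; rewrite powE // -/P => aP; split => //.
    rewrite -(ltr_int R); apply: le_lt_trans aP.
    by rewrite ler_peMr // ltW.
  have [j j5 jle] := log2_steps e0 e1.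
  have sz : (size w <= 3 * j + 52)%N.
    case: (leqP (size w) (3 * j)) => [h|h]; first exact: leq_trans h (leq_addr _ _).
    apply: (chain_size_of_large n0 dS H _ h).
    have w0 : (0 < size w)%N by apply: leq_ltn_trans h.
    have v0 : 3 * P `^ eps <= scaled R n w 0.
      have [_] := wX _ (mem_nth 0%N w0).
      rewrite /= powE // -/P => /ltW aP.
      rewrite /scaled ler_pdivlMr // -mulrA ler_pM2l // mulrC; exact: aP.
    have := scaled_pow R (i := 0) (j := j) n0 dS H h; rewrite add0n; apply: le_trans.
    apply: (@le_trans _ _ ((3 * P `^ eps) ^+ (2 ^ j))); last first.
      have p0 : 0 <= 3 * P `^ eps by rewrite mulr_ge0 // powR_ge0.
      by apply: lerXn2r; [exact: p0 | exact: le_trans p0 v0 | exact: v0].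
    rewrite !exprMn; apply: ler_pM; rewrite ?exprn_ge0 // ?(le_trans ler01 P1) //.
      apply: ler_weXn2l; first by rewrite ler1n.
      rewrite -(ler_nat R) natrX; apply: le_trans j5 _.
      by rewrite ler_piMl ?exprn_ge0 // ltW.
    have -> : (P `^ eps) ^+ (2 ^ j) = P `^ (eps * 2 ^+ j).
      by rewrite powRrM -natrX powR_mulrn // powR_ge0.
    by rewrite -(powR_mulrn 5 (le_trans ler01 P1)); exact: ler_powR.
  have : (size w)%:R <= 3 * j%:R + 52 :> R by rewrite -natrM -natrD ler_nat.
  have m1 : 1 <= Num.max 1 (ln (1 / eps)) by rewrite le_max lexx.
  have m2 : ln (1 / eps) <= Num.max 1 (ln (1 / eps)) by rewrite le_max lexx orbT.
  move: m1 m2 jle; move: (ln (1 / eps)) (Num.max _ _) => x y; lra.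
(* The growth of [scaled_growth] starts at index [11]. *)
- exists 12 => eps n e0 e1 n0; apply: ge_ereal_sup => _ [S dS <-].
  apply: counting_le => w sw wX.
  have P1 := norm1 _ n0; set P : R := `|n|%:~R in P1 *.
  have P0 : 0 < P by exact: lt_le_trans P1.
  have n2 : 0 < (n ^+ 2)%:~R :> R by rewrite ltr0z exprn_even_gt0.
  have H : large_chain n S w.
    by split=> // a /wX [Sa [/= na _]]; split => //; rewrite -(ltr_int R).
  have lnP : 0 <= eps * ln P by rewrite mulr_ge0 ?ln_ge0 // ltW.
  have [sz|sz] := leqP (size w) 12.
    have : (size w)%:R <= 12 :> R by rewrite ler_nat.
    by move: lnP; rewrite -mulrA; move: (eps * ln P) => x; lra.
  pose m := (size w - 12)%N.
  have sE : (size w = (11 + m).+1)%N by rewrite -addSn subnKC // ltnW.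
  have hm : (11 + m < size w)%N by rewrite sE.
  have := scaled_growth R n0 dS H hm.
  have [_ [_]] := wX _ (mem_nth 0%N hm).
  rewrite /= powE // -/P => aP.
  rewrite /scaled ler_pdivlMr // -[3 * _ * _]mulrA ler_pM2l // => /le_trans/(_ aP).
  rewrite [_ * _%:~R]mulrC ler_pM2l // => h0.
  have h : (8 * m)%:R * ln 3 <= eps * ln P.
    by rewrite mulr_natl -lnXn // -(ln_powR P) ler_ln // posrE ?exprn_gt0 ?powR_gt0.
  have l3 : 2^-1 <= ln 3 :> R.
    by apply: le_trans (ln2_ge R) _; rewrite ler_ln ?posrE // ler_nat.
  have h2 := ler_wpM2l (ler0n R (8 * m)) l3.
  have -> : (size w)%:R = 12 + m%:R :> R by rewrite sE -natr1 natrD; lra.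
  have := le_trans h2 h; rewrite natrM => h3; have m0 : 0 <= m%:R :> R by [].
  by move: lnP h3 m0; rewrite -[_ * eps * _]mulrA; move: (eps * ln P) => x; lra.
Qed.
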